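(* Let $(m_A)_{A\ge1}$ be a strictly increasing sequence of integers with $m_1\ge2$ such that $$\sup_{A}\frac{1}{|m_A|}\sum_{k=1}^{|m_A|}\bigl|\varepsilon_k(m_A)-\varepsilon_{k+1}(m_A)\bigr|\,l_{m_A(k-1)}<\infty .$$ Then for every $f\in L_1(\mathbb I)$, $L_{m_A}(x,f)\to f(x)$ as $A\to\infty$ for almost every $x\in\mathbb I$.
   Context: Let $\mathbb I=[0,1)$. Every $n\in\mathbb N$ is written $n=\sum_{j\ge0}\varepsilon_j(n)2^j$ with $\varepsilon_j(n)\in\{0,1\}$; for $n\ge1$, $|n|$ denotes the integer with $2^{|n|}\le n<2^{|n|+1}$; for $k\ge0$, $n(k):=\sum_{j=0}^{k}\varepsilon_j(n)2^j$. Every $x\in\mathbb I$ is written $x=\sum_{j\ge0}x_j2^{-(j+1)}$, $x_j\in\{0,1\}$ (for dyadic rationals, the expansion terminating in zeros). The Walsh–Paley functions are $w_n(x)=(-1)^{\sum_{k}\varepsilon_k(n)x_k}$. For $f\in L_1(\mathbb I)$, $\widehat f(i)=\int_{\mathbb I}f(t)w_i(t)\,dt$ and $S_M(x,f)=\sum_{i=0}^{M-1}\widehat f(i)w_i(x)$. Put $l_m:=\sum_{k=1}^{m-1}\frac1k$ (so $l_0=l_1=0$). The Nörlund logarithmic means are $$L_n(x,f):=\frac1{l_n}\sum_{k=1}^{n-1}\frac{S_k(x,f)}{n-k}\qquad(n\ge2).$$ *)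

(* Defs.v *)
From Stdlib Require Import Reals Lra Lia ZArith Arith.
Open Scope R_scope.

Fixpoint rsum (F : nat -> R) (n : nat) : R :=
  match n with O => 0 | S k => rsum F k + F k end.

Definition rsum_range (F : nat -> R) (a b : nat) : R :=
  rsum (fun i => F (a + i)%nat) (S b - a).

(* binary digit x_j of x in [0,1): x = sum x_j 2^{-(j+1)}, expansion
   terminating in zeros for dyadic rationals: x_j = floor(2^{j+1} x) mod 2 *)
Definition xdigit (x : R) (j : nat) : bool :=
  Z.odd (Int_part (x * 2 ^ (S j))).

Definition ndigit (n j : nat) : bool := Nat.testbit n j.

Definition b2n (b : bool) : nat := if b then 1%nat else 0%nat.

Fixpoint walsh_count (n : nat) (x : R) (N : nat) : nat :=
  match N with
  | O => O
  | S k => (walsh_count n x k + b2n (ndigit n k && xdigit x k))%nat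
  end.

(* Walsh-Paley function w_n(x) = (-1)^{sum_k eps_k(n) x_k};
   eps_k(n) = 0 for k >= n since n < 2^n. *)
Definition walsh (n : nat) (x : R) : R := (-1) ^ (walsh_count n x n).

Definition nlog (n : nat) : nat := Nat.log2 n.

(* n(k) = sum_{j=0}^k eps_j(n) 2^j *)
Definition ntrunc (n k : nat) : nat := (n mod 2 ^ (S k))%nat.

Definition lsum (m : nat) : R := rsum_range (fun k => / INR k) 1 (m - 1).

(* A McShane partition of [0,1] with n cells: points p 0 = 0 <= ... <= p n = 1,
   tags t i in [0,1] (not necessarily in their cell), delta-fine. *)
Definition mcshane_fine (delta : R -> R) (n : nat) (p t : nat -> R) : Prop :=
  p O = 0 /\ p n = 1 /\
  (forall i, (i < n)%nat ->
     p i <= p (S i) /\ 0 <= t i <= 1 /\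
     t i - delta (t i) < p i /\ p (S i) < t i + delta (t i)).

Definition riemann_sum (f : R -> R) (n : nat) (p t : nat -> R) : R :=
  rsum (fun i => f (t i) * (p (S i) - p i)) n.

(* I is the (McShane = Lebesgue) integral of f over [0,1] *)
Definition is_integral01 (f : R -> R) (I : R) : Prop :=
  forall eps, 0 < eps ->
  exists delta : R -> R, (forall x, 0 < delta x) /\
    forall n p t, mcshane_fine delta n p t ->
      Rabs (riemann_sum f n p t - I) < eps.

Definition L1 (f : R -> R) : Prop := exists I, is_integral01 f I.

Definition null_set (N : R -> Prop) : Prop :=
  forall eps, 0 < eps ->
  exists a b : nat -> R,
    (forall k, a k <= b k) /\
    (forall x, N x -> exists k, a k <= x <= b k) /\
    (forall K, rsum (fun k => b k - a k) K <= eps).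

(* Partial sums and logarithmic means, given the Walsh-Fourier
   coefficients c i = \hat f(i) *)
Definition Spart (c : nat -> R) (M : nat) (x : R) : R :=
  rsum (fun i => c i * walsh i x) M.

Definition Lmean (c : nat -> R) (n : nat) (x : R) : R :=
  / lsum n * rsum_range (fun k => Spart c k x / INR (n - k)) 1 (n - 1).

Definition cond_term (m : nat) : R :=
  / INR (nlog m) *
  rsum_range (fun k =>
      Rabs (INR (b2n (ndigit m k)) - INR (b2n (ndigit m (S k))))
      * lsum (ntrunc m (k - 1))) 1 (nlog m).

(* Main.v *)
(* The logarithmic mean is a convolution with a kernel [nkernel n / l_n].  Splitting off the
   leading binary digit of [n] gives a recursion for [nkernel n] whose error terms are
   dominated by the classical majorants [fejer_maj] of the Fejér kernels of order [2^s]; the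
   weights add up to O(|n| + variation n + l_n), hence to O(l_n) under the hypothesis.  The
   maximal operator of the Fejér majorants is of weak type (1,1): off the set where the dyadic
   maximal function exceeds [lam], its excess over [2 lam] is at most [bad_part], a function
   of integral at most |phi|.
   On the analytic side, tags of McShane partitions are free, so exchanging tags in one fine
   dyadic partition shows that its step function approximates [f] in L1.  The means of a step
   function converge everywhere, and the weak type inequality controls the remainder. *)

Require Import Defs.
From Stdlib Require Import Reals Lra Lia ZArith Arith.
From Stdlib Require Import FunctionalExtensionality Classical ClassicalEpsilon Cantor.
Open Scope R_scope.

(** Integration is replaced by finite averages over the first digits: [mean M] integrates a function
    of [M] digits exactly, and dyadic addition is [sxor]. Two obstacles shape the proof. A Walsh
    coefficient of $f$ is only approximately such an average, and one gauge serves only finitely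
    many indices; so the step function is fixed first, then a bound $2^M$ on the orders, and the
    tags last, with estimates that do not depend on $M$. Moreover the hypothesis concerns single
    orders $n$, while one exceptional set must serve them all; hence the kernel estimate is proved
    for an abstract monotone seminorm whose only input is a bound $2^s\Lambda$ on the Fejér
    majorants. At a point where their maximal operator is small this input holds for all $s$ at
    once, and convolution at that point is such a seminorm. The weights of the hypothesis arise from
    the leading terms $l_nD$ of the recursion: inside a block of ones they cancel up to a constant
    per digit, and where the digits change they survive. *)

Lemma rsum_ext (F G : nat -> R) (n : nat) :
  (forall i, (i < n)%nat -> F i = G i) -> rsum F n = rsum G n.
Proof.
  induction n as [|n IH]; intros H; simpl; [reflexivity|].
  rewrite IH by (intros; apply H; lia). rewrite H by lia. reflexivity.
Qed.

Lemma rsum_le (F G : nat -> R) (n : nat) :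
  (forall i, (i < n)%nat -> F i <= G i) -> rsum F n <= rsum G n.
Proof.
  induction n as [|n IH]; intros H; simpl; [lra|].
  apply Rplus_le_compat; [apply IH; intros; apply H; lia | apply H; lia].
Qed.

Lemma rsum_plus (F G : nat -> R) (n : nat) :
  rsum (fun i => F i + G i) n = rsum F n + rsum G n.
Proof. induction n as [|n IH]; simpl; [|rewrite IH]; lra. Qed.

Lemma rsum_scal (a : R) (F : nat -> R) (n : nat) :
  rsum (fun i => a * F i) n = a * rsum F n.
Proof. induction n as [|n IH]; simpl; [|rewrite IH]; lra. Qed.

Lemma rsum_const (a : R) (n : nat) : rsum (fun _ => a) n = INR n * a.
Proof.
  induction n as [|n IH]; [simpl; lra|].
  rewrite S_INR. simpl. rewrite IH. lra.
Qed.

Lemma rsum_nonneg (F : nat -> R) (n : nat) :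
  (forall i, (i < n)%nat -> 0 <= F i) -> 0 <= rsum F n.
Proof.
  intros H. replace 0 with (rsum (fun _ => 0) n) by (rewrite rsum_const; lra).
  now apply rsum_le.
Qed.

Lemma rsum_abs (F : nat -> R) (n : nat) :
  Rabs (rsum F n) <= rsum (fun i => Rabs (F i)) n.
Proof.
  induction n as [|n IH]; simpl; [rewrite Rabs_R0; lra|].
  eapply Rle_trans; [apply Rabs_triang|]. lra.
Qed.

Lemma rsum_split (F : nat -> R) (a b : nat) :
  rsum F (a + b) = rsum F a + rsum (fun i => F (a + i)%nat) b.
Proof.
  induction b as [|b IH].
  - rewrite Nat.add_0_r. simpl. lra.
  - rewrite Nat.add_succ_r. simpl. rewrite IH. lra.
Qed.

Lemma rsum_swap (F : nat -> nat -> R) (m n : nat) :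
  rsum (fun i => rsum (F i) n) m = rsum (fun j => rsum (fun i => F i j) m) n.
Proof.
  induction m as [|m IH]; simpl.
  - rewrite rsum_const. lra.
  - rewrite IH, <- rsum_plus. apply rsum_ext. reflexivity.
Qed.

Lemma rsum_shift (F : nat -> R) (n : nat) :
  rsum F (S n) = F O + rsum (fun i => F (S i)) n.
Proof.
  change (S n) with (1 + n)%nat. rewrite rsum_split. simpl. lra.
Qed.

Lemma rsum_rev (F : nat -> R) (n : nat) :
  rsum F n = rsum (fun i => F (n - 1 - i)%nat) n.
Proof.
  induction n as [|n IH]; [reflexivity|].
  rewrite (rsum_shift (fun i => F (S n - 1 - i)%nat)).
  simpl rsum at 1. rewrite IH, Rplus_comm.
  f_equal; [f_equal; lia|]. apply rsum_ext; intros; f_equal; lia.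
Qed.

Lemma rsum_mono (F : nat -> R) (a b : nat) :
  (a <= b)%nat -> (forall i, (a <= i < b)%nat -> 0 <= F i) -> rsum F a <= rsum F b.
Proof.
  intros Hab H. replace b with (a + (b - a))%nat by lia. rewrite rsum_split.
  assert (0 <= rsum (fun i => F (a + i)%nat) (b - a)); [|lra].
  apply rsum_nonneg; intros; apply H; lia.
Qed.

Lemma rsum_support (F : nat -> R) (a b : nat) :
  (forall i, 0 <= F i) -> (forall i, (a <= i)%nat -> F i = 0) -> rsum F b <= rsum F a.
Proof.
  intros H0 H. destruct (Nat.le_ge_cases b a) as [Hba|Hab].
  - apply rsum_mono; auto.
  - replace b with (a + (b - a))%nat by lia. rewrite rsum_split.
    rewrite (rsum_ext _ (fun _ => 0) (b - a)) by (intros; apply H; lia).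
    rewrite rsum_const. lra.
Qed.

Lemma rsum_single (F : nat -> R) (n i : nat) :
  (forall j, (j < n)%nat -> 0 <= F j) -> (i < n)%nat -> F i <= rsum F n.
Proof.
  intros H Hi. apply Rle_trans with (rsum F (S i)).
  - simpl. assert (0 <= rsum F i) by (apply rsum_nonneg; intros; apply H; lia). lra.
  - apply rsum_mono; [lia|]. intros; apply H; lia.
Qed.

(** * Digit sequences and averages over their first digits *)

Definition digits := nat -> bool.

Definition scons (b : bool) (z : digits) : digits :=
  fun k => match k with O => b | S k => z k end.

Definition stail (z : digits) : digits := fun k => z (S k).

Definition szero : digits := fun _ => false.

Definition sxor (z y : digits) : digits := fun k => xorb (z k) (y k).

Definition strunc (K : nat) (z : digits) : digits :=
  fun k => if (k <? K)%nat then z k else false.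

Definition flip (l : nat) (z : digits) : digits :=
  fun k => if (k =? l)%nat then negb (z k) else z k.

Definition supp (K : nat) (z : digits) : Prop := forall k, (K <= k)%nat -> z k = false.

Definition agree (K : nat) (z y : digits) : Prop := forall k, (k < K)%nat -> z k = y k.

Definition depends {T : Type} (K : nat) (u : digits -> T) : Prop :=
  forall z y, agree K z y -> u z = u y.

(** When [depends M u] holds, this is the integral of [u] over $\mathbb I$; the recursion halves the
    interval at the first digit. *)
Fixpoint mean (M : nat) (u : digits -> R) : R :=
  match M with
  | O => u szero
  | S M => (mean M (fun z => u (scons false z)) + mean M (fun z => u (scons true z))) / 2
  end.

Lemma supp_szero (M : nat) : supp M szero.
Proof. intros k _. reflexivity. Qed.

Lemma supp_scons (M : nat) (b : bool) (z : digits) : supp M z -> supp (S M) (scons b z).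
Proof. intros H [|k] Hk; [lia|]. apply H. lia. Qed.

Lemma supp_strunc (K : nat) (z : digits) : supp K (strunc K z).
Proof. intros k Hk. unfold strunc. destruct (Nat.ltb_spec k K); [lia|reflexivity]. Qed.

Lemma strunc_agree (K L : nat) (z : digits) : (K <= L)%nat -> agree K (strunc L z) z.
Proof. intros HKL k Hk. unfold strunc. destruct (Nat.ltb_spec k L); [reflexivity|lia]. Qed.

Lemma strunc_depends (K : nat) : depends K (strunc K).
Proof.
  intros z y H. extensionality k. unfold strunc.
  destruct (Nat.ltb_spec k K); [now apply H|reflexivity].
Qed.

Lemma depends_weaken {T : Type} (K L : nat) (u : digits -> T) :
  (K <= L)%nat -> depends K u -> depends L u.
Proof. intros HKL H z y Hzy. apply H. intros k Hk. apply Hzy. lia. Qed.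

Lemma agree_sym (K : nat) (z y : digits) : agree K z y -> agree K y z.
Proof. intros H k Hk. symmetry. now apply H. Qed.

Lemma agree_trans (K : nat) (x y z : digits) : agree K x y -> agree K y z -> agree K x z.
Proof. intros H1 H2 k Hk. rewrite H1, H2 by lia. reflexivity. Qed.

Lemma agree_sxor (K : nat) (x x' y y' : digits) :
  agree K x x' -> agree K y y' -> agree K (sxor x y) (sxor x' y').
Proof. intros H1 H2 k Hk. unfold sxor. rewrite H1, H2 by lia. reflexivity. Qed.

Lemma agree_flip (K l : nat) (z : digits) : (K <= l)%nat -> agree K (flip l z) z.
Proof. intros H k Hk. unfold flip. destruct (Nat.eqb_spec k l); [lia|reflexivity]. Qed.

Lemma flip_as_sxor (l : nat) (z : digits) : flip l z = sxor z (flip l szero).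
Proof.
  extensionality k. unfold flip, sxor, szero.
  destruct (Nat.eqb k l); destruct (z k); reflexivity.
Qed.

Lemma supp_flip (M l : nat) (z : digits) : (l < M)%nat -> supp M z -> supp M (flip l z).
Proof.
  intros Hl H k Hk. unfold flip. destruct (Nat.eqb_spec k l); [lia|]. now apply H.
Qed.

Lemma sxor_comm (x y : digits) : sxor x y = sxor y x.
Proof. extensionality k. unfold sxor. apply Bool.xorb_comm. Qed.

Lemma flip_sxor (l : nat) (x y : digits) : flip l (sxor x y) = sxor (flip l x) y.
Proof.
  extensionality k. unfold flip, sxor.
  destruct (Nat.eqb k l); destruct (x k), (y k); reflexivity.
Qed.

Lemma mean_le (M : nat) : forall u v : digits -> R,
  (forall z, supp M z -> u z <= v z) -> mean M u <= mean M v.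
Proof.
  induction M as [|M IH]; intros u v H; simpl.
  - apply H. apply supp_szero.
  - assert (H1 := IH (fun z => u (scons false z)) (fun z => v (scons false z))).
    assert (H2 := IH (fun z => u (scons true z)) (fun z => v (scons true z))).
    assert (Hs : forall b z, supp M z -> u (scons b z) <= v (scons b z))
      by (intros; apply H; now apply supp_scons).
    specialize (H1 (Hs false)). specialize (H2 (Hs true)). lra.
Qed.

Lemma mean_ext (M : nat) (u v : digits -> R) :
  (forall z, supp M z -> u z = v z) -> mean M u = mean M v.
Proof. intros H. apply Rle_antisym; apply mean_le; intros z Hz; rewrite H by assumption; lra. Qed.

Lemma mean_plus (M : nat) : forall u v : digits -> R,
  mean M (fun z => u z + v z) = mean M u + mean M v.
Proof.
  induction M as [|M IH]; intros u v; simpl; [reflexivity|].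
  rewrite (IH (fun z => u (scons false z))), (IH (fun z => u (scons true z))). lra.
Qed.

Lemma mean_scal (M : nat) : forall (a : R) (u : digits -> R),
  mean M (fun z => a * u z) = a * mean M u.
Proof.
  induction M as [|M IH]; intros a u; simpl; [reflexivity|].
  rewrite (IH a (fun z => u (scons false z))), (IH a (fun z => u (scons true z))). lra.
Qed.

Lemma mean_const (M : nat) (a : R) : mean M (fun _ => a) = a.
Proof. induction M as [|M IH]; simpl; [reflexivity|]. rewrite IH. lra. Qed.

Lemma mean_minus (M : nat) (u v : digits -> R) :
  mean M (fun z => u z - v z) = mean M u - mean M v.
Proof.
  rewrite (mean_ext M _ (fun z => u z + (-1) * v z)) by (intros; lra).
  rewrite mean_plus, mean_scal. lra.
Qed.

Lemma mean_nonneg (M : nat) (u : digits -> R) :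
  (forall z, supp M z -> 0 <= u z) -> 0 <= mean M u.
Proof. intros H. rewrite <- (mean_const M 0). now apply mean_le. Qed.

Lemma mean_abs (M : nat) (u : digits -> R) : Rabs (mean M u) <= mean M (fun z => Rabs (u z)).
Proof.
  apply Rabs_le. split.
  - replace (- mean M (fun z => Rabs (u z))) with ((-1) * mean M (fun z => Rabs (u z))) by lra.
    rewrite <- mean_scal. apply mean_le. intros z _.
    generalize (Rle_abs (- u z)). rewrite Rabs_Ropp. lra.
  - apply mean_le. intros. apply Rle_abs.
Qed.

Lemma mean_rsum (M n : nat) (u : nat -> digits -> R) :
  mean M (fun z => rsum (fun i => u i z) n) = rsum (fun i => mean M (u i)) n.
Proof.
  induction n as [|n IH]; simpl; [apply mean_const|].
  rewrite (mean_plus M (fun z => rsum (fun i => u i z) n)), IH. reflexivity.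
Qed.

Lemma mean_swap (M L : nat) : forall u : digits -> digits -> R,
  mean M (fun x => mean L (u x)) = mean L (fun y => mean M (fun x => u x y)).
Proof.
  induction M as [|M IH]; intros u; simpl; [reflexivity|].
  rewrite (IH (fun x => u (scons false x))), (IH (fun x => u (scons true x))).
  rewrite <- mean_plus. unfold Rdiv. rewrite Rmult_comm, <- mean_scal.
  apply mean_ext. intros. lra.
Qed.

Lemma mean_depends_S (M : nat) : forall u : digits -> R,
  depends M u -> mean (S M) u = mean M u.
Proof.
  induction M as [|M IH]; intros u H.
  - simpl. rewrite (H (scons false szero) szero), (H (scons true szero) szero)
      by (intros k Hk; lia). lra.
  - assert (E : forall b, mean (S M) (fun z => u (scons b z)) = mean M (fun z => u (scons b z))).
    { intros b. apply IH. intros z y Hzy. apply H.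
      intros [|k] Hk; simpl; [reflexivity|]. apply Hzy. lia. }
    change (mean (S (S M)) u) with ((mean (S M) (fun z => u (scons false z))
       + mean (S M) (fun z => u (scons true z))) / 2).
    rewrite (E false), (E true). reflexivity.
Qed.

Lemma mean_depends (M K : nat) (u : digits -> R) :
  depends K u -> (K <= M)%nat -> mean M u = mean K u.
Proof.
  intros H HKM. induction HKM as [|M HKM IH]; [reflexivity|].
  rewrite mean_depends_S; [assumption|]. now apply depends_weaken with K.
Qed.

(** Invariance of Haar measure on the dyadic group: the first digit of [a] at most exchanges the two
    halves. *)
Lemma mean_translate (M : nat) : forall (a : digits) (u : digits -> R),
  supp M a -> mean M (fun z => u (sxor z a)) = mean M u.
Proof.
  induction M as [|M IH]; intros a u Ha.
  - simpl. f_equal. extensionality k. unfold sxor. rewrite Ha by lia. reflexivity.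
  - assert (Ht : supp M (stail a)) by (intros k Hk; apply Ha; lia).
    assert (E : forall b, mean M (fun z => u (sxor (scons b z) a))
                  = mean M (fun z => u (scons (xorb b (a O)) z))).
    { intros b. rewrite <- (IH (stail a) (fun z => u (scons (xorb b (a O)) z)) Ht).
      apply mean_ext. intros z _. f_equal. extensionality k. destruct k; reflexivity. }
    simpl. rewrite (E false), (E true). destruct (a O); simpl; lra.
Qed.

Lemma mean_flip (M l : nat) (u : digits -> R) :
  (l < M)%nat -> mean M (fun z => u (flip l z)) = mean M u.
Proof.
  intros Hl. rewrite <- (mean_translate M (flip l szero) u).
  - apply mean_ext. intros z _. now rewrite flip_as_sxor.
  - apply supp_flip; [assumption|apply supp_szero].
Qed.

(** Position 0 holds the most significant bit of [j], so that [dig M] lists the cells of length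
    $2^{-M}$ from left to right and [mean] becomes a Riemann sum. *)
Fixpoint dig (M j : nat) : digits :=
  match M with
  | O => szero
  | S M => if (j <? 2 ^ M)%nat then scons false (dig M j) else scons true (dig M (j - 2 ^ M))
  end.

Lemma supp_dig (M : nat) : forall j, supp M (dig M j).
Proof.
  induction M as [|M IH]; intros j; simpl; [apply supp_szero|].
  destruct (j <? 2 ^ M)%nat; now apply supp_scons.
Qed.

Lemma mean_dig (M : nat) : forall u : digits -> R,
  mean M u = / 2 ^ M * rsum (fun j => u (dig M j)) (2 ^ M).
Proof.
  induction M as [|M IH]; intros u.
  - simpl. lra.
  - simpl mean. rewrite (IH (fun z => u (scons false z))), (IH (fun z => u (scons true z))).
    replace (2 ^ S M)%nat with (2 ^ M + 2 ^ M)%nat by (simpl; lia).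
    rewrite rsum_split.
    rewrite (rsum_ext (fun j => u (dig (S M) j)) (fun j => u (scons false (dig M j)))).
    2:{ intros i Hi. simpl. destruct (Nat.ltb_spec i (2 ^ M)); [reflexivity|lia]. }
    rewrite (rsum_ext (fun j => u (dig (S M) (2 ^ M + j))) (fun j => u (scons true (dig M j)))).
    2:{ intros i Hi. simpl. destruct (Nat.ltb_spec (2 ^ M + i) (2 ^ M)); [lia|].
        do 3 f_equal. lia. }
    simpl pow. field. apply pow_nonzero. lra.
Qed.

Lemma dig_surj (M : nat) : forall z, exists j, (j < 2 ^ M)%nat /\ dig M j = strunc M z.
Proof.
  induction M as [|M IH]; intros z.
  - exists O. split; [simpl; lia|]. extensionality k. reflexivity.
  - destruct (IH (stail z)) as [j [Hj Ej]].
    exists (if z O then (2 ^ M + j)%nat else j). split.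
    { simpl. destruct (z O); lia. }
    assert (E : strunc (S M) z = scons (z O) (strunc M (stail z))).
    { extensionality k. destruct k; reflexivity. }
    rewrite E, <- Ej. simpl. destruct (z O).
    + destruct (Nat.ltb_spec (2 ^ M + j) (2 ^ M)); [lia|]. do 2 f_equal. lia.
    + destruct (Nat.ltb_spec j (2 ^ M)); [reflexivity|lia].
Qed.

(** * Walsh functions and Dirichlet kernels on digit sequences *)

Lemma testbit_high (n k : nat) : (n < 2 ^ k)%nat -> Nat.testbit n k = false.
Proof. intros H. rewrite Nat.testbit_eqb, Nat.div_small by assumption. reflexivity. Qed.

Lemma testbit_pow2_add_low (k j i : nat) :
  (i < k)%nat -> Nat.testbit (2 ^ k + j) i = Nat.testbit j i.
Proof.
  intros Hi. rewrite !Nat.testbit_eqb.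
  replace (2 ^ k)%nat with (2 ^ S (k - S i) * 2 ^ i)%nat
    by (rewrite <- Nat.pow_add_r; f_equal; lia).
  rewrite Nat.div_add_l by (apply Nat.pow_nonzero; lia).
  rewrite Nat.pow_succ_r', (Nat.add_comm (2 * _)), Nat.mul_comm, Nat.Div0.mod_add.
  reflexivity.
Qed.

Lemma testbit_pow2_add_eq (k j : nat) : (j < 2 ^ k)%nat -> Nat.testbit (2 ^ k + j) k = true.
Proof.
  intros Hj. rewrite Nat.testbit_eqb.
  rewrite <- (Nat.mul_1_l (2 ^ k)) at 1.
  rewrite Nat.div_add_l by (apply Nat.pow_nonzero; lia).
  rewrite Nat.div_small by assumption. reflexivity.
Qed.

Lemma testbit_pow2_pred_sub (k j i : nat) :
  (j < 2 ^ k)%nat -> (i < k)%nat ->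
  Nat.testbit (2 ^ k - 1 - j) i = negb (Nat.testbit j i).
Proof.
  intros Hj Hi. rewrite <- (Nat.lnot_spec_low j k i Hi). f_equal.
  destruct j as [|j].
  - rewrite Nat.lnot_0_l, Nat.ones_equiv. lia.
  - rewrite Nat.lnot_sub_low by (apply Nat.log2_lt_pow2; lia).
    rewrite Nat.ones_equiv. lia.
Qed.

(** The cutoff [K] is separate from the order [n], so that different orders can be compared at a
    common cutoff. *)
Fixpoint walp (n : nat) (z : digits) (K : nat) : R :=
  match K with
  | O => 1
  | S k => walp n z k * (if (ndigit n k && z k)%bool then -1 else 1)
  end.

Definition wal (n : nat) (z : digits) : R := walp n z n.

Definition rad (k : nat) (z : digits) : R := if z k then -1 else 1.

Lemma walsh_wal (n : nat) (x : R) : walsh n x = wal n (xdigit x).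
Proof.
  (* Only the cutoffs are generalised; the order stays [n]. *)
  unfold walsh, wal. generalize n at 2 4. intros K. induction K as [|K IH]; simpl; [reflexivity|].
  rewrite pow_add, IH. destruct (ndigit n K && xdigit x K)%bool; simpl; lra.
Qed.

Lemma walp_stable (n K L : nat) (z : digits) :
  (n < 2 ^ K)%nat -> (K <= L)%nat -> walp n z L = walp n z K.
Proof.
  intros Hn HKL. induction HKL as [|L HKL IH]; [reflexivity|]. simpl. rewrite IH.
  unfold ndigit. rewrite testbit_high; [simpl; lra|].
  apply Nat.lt_le_trans with (2 ^ K)%nat; [assumption|]. apply Nat.pow_le_mono_r; lia.
Qed.

Lemma wal_walp (n K : nat) (z : digits) : (n < 2 ^ K)%nat -> wal n z = walp n z K.
Proof.
  intros Hn. unfold wal.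
  assert (n < 2 ^ n)%nat by (apply Nat.pow_gt_lin_r; lia).
  rewrite <- (walp_stable n n (Nat.max n K) z) by (auto; lia).
  apply walp_stable; [assumption|lia].
Qed.

Lemma walp_abs (n : nat) (z : digits) (K : nat) : Rabs (walp n z K) = 1.
Proof.
  induction K as [|K IH]; simpl; [apply Rabs_R1|].
  rewrite Rabs_mult, IH. destruct (ndigit n K && z K)%bool.
  - rewrite Rabs_left; lra.
  - rewrite Rabs_R1; lra.
Qed.

Lemma wal_abs (n : nat) (z : digits) : Rabs (wal n z) = 1.
Proof. apply walp_abs. Qed.

Lemma rad_abs (k : nat) (z : digits) : Rabs (rad k z) = 1.
Proof. unfold rad. destruct (z k); [rewrite Rabs_left; lra|apply Rabs_R1]. Qed.

Lemma walp_sxor (n : nat) (x y : digits) (K : nat) :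
  walp n (sxor x y) K = walp n x K * walp n y K.
Proof.
  induction K as [|K IH]; simpl; [lra|]. rewrite IH. unfold sxor.
  destruct (ndigit n K), (x K), (y K); simpl; lra.
Qed.

Lemma wal_sxor (n : nat) (x y : digits) : wal n (sxor x y) = wal n x * wal n y.
Proof. apply walp_sxor. Qed.

Lemma walp_agree (n K : nat) (x y : digits) : agree K x y -> walp n x K = walp n y K.
Proof.
  intros H. induction K as [|K IH]; simpl; [reflexivity|].
  rewrite IH by (intros k Hk; apply H; lia). rewrite (H K) by lia. reflexivity.
Qed.

Lemma wal_depends (n K : nat) : (n < 2 ^ K)%nat -> depends K (wal n).
Proof. intros Hn x y H. rewrite !(wal_walp n K) by assumption. now apply walp_agree. Qed.

Lemma walp_ndigit (n m : nat) (z : digits) (K : nat) :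
  (forall i, (i < K)%nat -> Nat.testbit n i = Nat.testbit m i) -> walp n z K = walp m z K.
Proof.
  intros H. induction K as [|K IH]; simpl; [reflexivity|].
  rewrite IH by (intros; apply H; lia). unfold ndigit. rewrite H by lia. reflexivity.
Qed.

Lemma wal_pow2_add (k j : nat) (z : digits) :
  (j < 2 ^ k)%nat -> wal (2 ^ k + j) z = rad k z * wal j z.
Proof.
  intros Hj. rewrite (wal_walp (2 ^ k + j) (S k)) by (simpl; lia).
  rewrite (wal_walp j k) by assumption. simpl walp.
  rewrite (walp_ndigit (2 ^ k + j) j z k) by (intros; now apply testbit_pow2_add_low).
  unfold ndigit. rewrite testbit_pow2_add_eq by assumption. unfold rad. simpl.
  destruct (z k); lra.
Qed.

Lemma wal_pow2_pred_sub (k j : nat) (z : digits) :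
  (j < 2 ^ k)%nat -> wal (2 ^ k - 1 - j) z = wal (2 ^ k - 1) z * wal j z.
Proof.
  intros Hj. rewrite !(wal_walp _ k) by lia.
  assert (H : forall K, (K <= k)%nat ->
            walp (2 ^ k - 1 - j) z K = walp (2 ^ k - 1) z K * walp j z K).
  { induction K as [|K IH]; intros HK; simpl; [lra|]. rewrite IH by lia. unfold ndigit.
    rewrite testbit_pow2_pred_sub by lia.
    assert (E := testbit_pow2_pred_sub k 0 K ltac:(lia) ltac:(lia)).
    rewrite Nat.sub_0_r in E. rewrite E, Nat.bits_0.
    destruct (Nat.testbit j K), (z K); simpl; lra. }
  apply H. lia.
Qed.

Definition dirichlet (n : nat) (z : digits) : R := rsum (fun i => wal i z) n.

Lemma dirichlet_0 (z : digits) : dirichlet 0 z = 0.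
Proof. reflexivity. Qed.

Lemma dirichlet_pow2_add (k j : nat) (z : digits) :
  (j <= 2 ^ k)%nat -> dirichlet (2 ^ k + j) z = dirichlet (2 ^ k) z + rad k z * dirichlet j z.
Proof.
  intros Hj. unfold dirichlet. rewrite rsum_split. f_equal. rewrite <- rsum_scal.
  apply rsum_ext. intros i Hi. apply wal_pow2_add. lia.
Qed.

(** The omitted orders are $2^k-1-i$ with $i<j$; complementing the low [k] bits multiplies a Walsh
    function by $w_{2^k-1}$. *)
Lemma dirichlet_pow2_sub (k j : nat) (z : digits) :
  (j <= 2 ^ k)%nat ->
  dirichlet (2 ^ k - j) z = dirichlet (2 ^ k) z - wal (2 ^ k - 1) z * dirichlet j z.
Proof.
  induction j as [|j IH]; intros Hj.
  - rewrite Nat.sub_0_r, dirichlet_0. lra.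
  - specialize (IH ltac:(lia)).
    replace (2 ^ k - j)%nat with (S (2 ^ k - 1 - j)) in IH by lia.
    replace (2 ^ k - S j)%nat with (2 ^ k - 1 - j)%nat by lia.
    unfold dirichlet in *. simpl rsum in *.
    rewrite wal_pow2_pred_sub in IH by lia. lra.
Qed.

(** Classically $2^k$ times the indicator of $[0,2^{-k})$: each factor $1+r_i$ in [D2_S] is 2 or
    0. *)
Definition D2 (k : nat) (z : digits) : R := dirichlet (2 ^ k) z.

Lemma D2_0 (z : digits) : D2 0 z = 1.
Proof. unfold D2, dirichlet, wal. simpl. lra. Qed.

Lemma D2_S (k : nat) (z : digits) : D2 (S k) z = (1 + rad k z) * D2 k z.
Proof.
  unfold D2. replace (2 ^ S k)%nat with (2 ^ k + 2 ^ k)%nat by (simpl; lia).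
  rewrite dirichlet_pow2_add by lia. lra.
Qed.

Lemma D2_nonneg (k : nat) (z : digits) : 0 <= D2 k z.
Proof.
  induction k as [|k IH]; [rewrite D2_0; lra|]. rewrite D2_S. unfold rad.
  destruct (z k); nra.
Qed.

Lemma D2_depends (k : nat) : depends k (D2 k).
Proof.
  intros x y H. unfold D2, dirichlet. apply rsum_ext. intros i Hi.
  now apply (wal_depends i k).
Qed.

Lemma D2_nonzero (k i : nat) (z : digits) : (i < k)%nat -> z i = true -> D2 k z = 0.
Proof.
  induction k as [|k IH]; intros Hi Hz; [lia|]. rewrite D2_S.
  destruct (Nat.eq_dec i k) as [->|Hne].
  - unfold rad. rewrite Hz. lra.
  - rewrite IH by (auto; lia). lra.
Qed.

Lemma D2_not_agree (k : nat) (x y : digits) : ~ agree k x y -> D2 k (sxor x y) = 0.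
Proof.
  intros H. apply not_all_ex_not in H. destruct H as [i H].
  apply imply_to_and in H. destruct H as [Hi H].
  apply (D2_nonzero k i); [assumption|]. unfold sxor.
  destruct (x i), (y i); simpl; congruence.
Qed.

Lemma D2_le (k l : nat) (z : digits) : (k <= l)%nat -> D2 l z / 2 ^ l <= D2 k z / 2 ^ k.
Proof.
  intros H. induction H as [|l H IH]; [lra|]. eapply Rle_trans; [|exact IH].
  rewrite D2_S. simpl. assert (0 < 2 ^ l) by (apply pow_lt; lra).
  assert (0 <= D2 l z / 2 ^ l) by (apply Rle_mult_inv_pos; [apply D2_nonneg|assumption]).
  replace ((1 + rad l z) * D2 l z / (2 * 2 ^ l)) with (((1 + rad l z) / 2) * (D2 l z / 2 ^ l))
    by (field; lra).
  unfold rad. destruct (z l); nra.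
Qed.

Lemma mean_D2 (M k : nat) (y : digits) : (k <= M)%nat -> supp M y ->
  mean M (fun x => D2 k (sxor x y)) = 1.
Proof.
  intros Hk Hy. rewrite (mean_translate M y (D2 k)) by assumption.
  rewrite (mean_depends M k) by (auto using D2_depends). clear.
  assert (H : forall m, (m <= k)%nat -> mean m (D2 m) = 1).
  { intros m _. clear k. induction m as [|m IH]; [apply D2_0|].
    rewrite (mean_ext (S m) _ (fun z => D2 m z + rad m z * D2 m z))
      by (intros; rewrite D2_S; lra).
    rewrite mean_plus, mean_depends_S, IH by apply D2_depends.
    (* Flipping digit [m] changes the sign of [rad m] and leaves [D2 m] alone, so the mean of their
       product vanishes. *)
    assert (E := mean_flip (S m) m (fun z => rad m z * D2 m z) ltac:(lia)).
    cbv beta in E.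
    rewrite (mean_ext (S m) (fun z => rad m (flip m z) * D2 m (flip m z))
      (fun z => -1 * (rad m z * D2 m z))) in E.
    - rewrite mean_scal in E. lra.
    - intros z _. rewrite (D2_depends m (flip m z) z) by (now apply agree_flip).
      unfold rad, flip. rewrite Nat.eqb_refl. destruct (z m); simpl; lra. }
  now apply H.
Qed.

(** * Fejér kernels *)

Definition fejer (n : nat) (z : digits) : R := rsum (fun j => dirichlet (S j) z) n.

Lemma fejer_pow2_add (k j : nat) (z : digits) :
  (j <= 2 ^ k)%nat ->
  fejer (2 ^ k + j) z = fejer (2 ^ k) z + INR j * D2 k z + rad k z * fejer j z.
Proof.
  intros Hj. unfold fejer. rewrite rsum_split.
  rewrite (rsum_ext (fun i => dirichlet (S (2 ^ k + i)) z)
             (fun i => D2 k z + rad k z * dirichlet (S i) z)).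
  - rewrite rsum_plus, rsum_const, rsum_scal. lra.
  - intros i Hi. rewrite <- Nat.add_succ_r. rewrite dirichlet_pow2_add by lia. reflexivity.
Qed.

(* Equal to [2 * fejer (2 ^ k) z - D2 k z]; the explicit form is the one that can be
   averaged. *)
Definition fejer_maj (k : nat) (z : digits) : R :=
  2 ^ k * D2 k z + rsum (fun l => 2 ^ l * D2 k (flip l z)) k.

(** The new summand [l = k] carries the factor $1-r_k$; together with half of the main term
    $2^{k+1}(1+r_k)D_{2^k}$ it yields the last term. *)
Lemma fejer_maj_S (k : nat) (z : digits) :
  fejer_maj (S k) z = (1 + rad k z) * fejer_maj k z + 2 * (2 ^ k * D2 k z).
Proof.
  unfold fejer_maj. simpl rsum. rewrite (D2_S k z), (D2_S k (flip k z)).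
  rewrite (D2_depends k (flip k z) z) by (now apply agree_flip).
  rewrite (rsum_ext (fun l => 2 ^ l * D2 (S k) (flip l z))
             (fun l => (1 + rad k z) * (2 ^ l * D2 k (flip l z)))).
  - rewrite rsum_scal.
    assert (E : rad k (flip k z) = - rad k z).
    { unfold rad, flip. rewrite Nat.eqb_refl. destruct (z k); simpl; lra. }
    rewrite E. simpl pow. ring.
  - intros l Hl. rewrite D2_S. unfold rad, flip.
    destruct (Nat.eqb_spec k l); [lia|]. ring.
Qed.

Lemma fejer_maj_nonneg (k : nat) (z : digits) : 0 <= fejer_maj k z.
Proof.
  assert (P : forall i, 0 < 2 ^ i) by (intros; apply pow_lt; lra).
  unfold fejer_maj. apply Rplus_le_le_0_compat.
  - apply Rmult_le_pos; [apply Rlt_le, P|apply D2_nonneg].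
  - apply rsum_nonneg. intros. apply Rmult_le_pos; [apply Rlt_le, P|apply D2_nonneg].
Qed.

Lemma D2_le_fejer_maj (k : nat) (z : digits) : 2 ^ k * D2 k z <= fejer_maj k z.
Proof.
  unfold fejer_maj. assert (0 <= rsum (fun l => 2 ^ l * D2 k (flip l z)) k); [|lra].
  apply rsum_nonneg. intros. apply Rmult_le_pos; [apply pow_le; lra|apply D2_nonneg].
Qed.

Lemma INR_pow2 (k : nat) : INR (2 ^ k) = 2 ^ k.
Proof. rewrite pow_INR. reflexivity. Qed.

(** The Fejér kernels of order $2^k$ satisfy the recursion of [fejer_maj_S] with half its
    inhomogeneous term, so both bounds propagate. *)
Lemma fejer_pow2 (k : nat) (z : digits) : 0 <= fejer (2 ^ k) z <= fejer_maj k z.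
Proof.
  induction k as [|k IH].
  - unfold fejer, fejer_maj. simpl. unfold dirichlet, wal, walp. simpl.
    rewrite D2_0. lra.
  - rewrite fejer_maj_S. replace (2 ^ S k)%nat with (2 ^ k + 2 ^ k)%nat by (simpl; lia).
    rewrite fejer_pow2_add by lia. rewrite INR_pow2.
    assert (0 <= 2 ^ k * D2 k z)
      by (apply Rmult_le_pos; [apply pow_le; lra|apply D2_nonneg]).
    unfold rad. destruct (z k); nra.
Qed.

Definition chi (P : Prop) : R := if excluded_middle_informative P then 1 else 0.

Lemma chi_true (P : Prop) : P -> chi P = 1.
Proof. unfold chi. destruct (excluded_middle_informative P); tauto. Qed.

Lemma chi_false (P : Prop) : ~ P -> chi P = 0.
Proof. unfold chi. destruct (excluded_middle_informative P); tauto. Qed.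

Lemma chi_bounds (P : Prop) : 0 <= chi P <= 1.
Proof. unfold chi. destruct (excluded_middle_informative P); lra. Qed.

Lemma chi_mono (P Q : Prop) : (P -> Q) -> chi P <= chi Q.
Proof.
  intros H. unfold chi.
  destruct (excluded_middle_informative P), (excluded_middle_informative Q); (lra || tauto).
Qed.

(** Each binary digit of [n] costs [fejer_maj] twice: once for the Fejér kernel of order $2^k$, once
    for $jD_{2^k}\le 2^kD_{2^k}$. The cutoff $2^s\le n$ is kept because Abel summation turns it into
    the weight $1/(r+2^s)$. *)
Lemma fejer_bound (k : nat) (z : digits) : forall n, (n < 2 ^ k)%nat ->
  Rabs (fejer n z) <= rsum (fun s => 2 * fejer_maj s z * chi (2 ^ s <= n)%nat) k.
Proof.
  induction k as [|k IH]; intros n Hn.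
  - simpl in Hn. replace n with O by lia. unfold fejer. simpl. rewrite Rabs_R0. lra.
  - assert (Hpos : forall s P, 0 <= 2 * fejer_maj s z * chi P).
    { intros s P. assert (A := fejer_maj_nonneg s z). destruct (chi_bounds P). nra. }
    simpl rsum. destruct (Nat.lt_ge_cases n (2 ^ k)) as [Hlt|Hge].
    + assert (A := IH n Hlt). assert (B := Hpos k (2 ^ k <= n)%nat). lra.
    + rewrite (chi_true (2 ^ k <= n)%nat) by assumption.
      set (j := (n - 2 ^ k)%nat). replace n with (2 ^ k + j)%nat by (unfold j; lia).
      assert (Hj : (j < 2 ^ k)%nat) by (simpl in Hn; unfold j; lia).
      rewrite fejer_pow2_add by lia.
      eapply Rle_trans; [apply Rabs_triang|]. rewrite Rabs_mult, rad_abs, Rmult_1_l.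
      assert (A := IH j Hj).
      assert (B : rsum (fun s => 2 * fejer_maj s z * chi (2 ^ s <= j)%nat) k <=
                  rsum (fun s => 2 * fejer_maj s z * chi (2 ^ s <= 2 ^ k + j)%nat) k).
      { apply rsum_le. intros s _. apply Rmult_le_compat_l.
        - assert (C := fejer_maj_nonneg s z). lra.
        - apply chi_mono. lia. }
      assert (C := fejer_pow2 k z). assert (E := D2_le_fejer_maj k z).
      assert (F : 0 <= INR j * D2 k z <= 2 ^ k * D2 k z).
      { split.
        - apply Rmult_le_pos; [apply pos_INR|apply D2_nonneg].
        - apply Rmult_le_compat_r; [apply D2_nonneg|]. rewrite <- INR_pow2.
          apply le_INR. lia. }
      rewrite Rabs_right by lra. lra.
Qed.

(** What the orders below $2^k$ contribute to [nkernel (2 ^ k + r)] after the reflection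
    [dirichlet_pow2_sub], apart from multiples of [D2 k] and a unimodular factor. *)
Definition tkernel (k r : nat) (z : digits) : R :=
  rsum (fun i => dirichlet (S i) z * / INR (r + S i)) (2 ^ k - 1).

(* Abel summation: the bound of [fejer_bound] jumps only at powers of two, so the
   differences of [1 / (r + j)] telescope. *)
Lemma tkernel_bound (k r : nat) (z : digits) :
  Rabs (tkernel k r z) <= rsum (fun s => 2 * fejer_maj s z * / INR (r + 2 ^ s)) k.
Proof.
  set (a := fun j => / INR (r + S j)).
  assert (Hdec : forall j, 0 <= a (S j) <= a j).
  { intros j. unfold a. split.
    - apply Rlt_le, Rinv_0_lt_compat, lt_0_INR. lia.
    - apply Rinv_le_contravar; [apply lt_0_INR; lia|]. apply le_INR. lia. }
  assert (H : forall J, (J < 2 ^ k)%nat ->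
     Rabs (rsum (fun i => dirichlet (S i) z * a i) J - fejer J z * a J)
     <= rsum (fun s => 2 * fejer_maj s z * (chi (2 ^ s <= J)%nat * (/ INR (r + 2 ^ s) - a J))) k).
  { induction J as [|J IH]; intros HJ.
    - unfold fejer. simpl. replace (0 - 0 * a 0%nat) with 0 by lra. rewrite Rabs_R0.
      apply rsum_nonneg. intros s _. rewrite chi_false; [lra|].
      assert (2 ^ s <> 0)%nat by (apply Nat.pow_nonzero; lia). lia.
    - specialize (IH ltac:(lia)).
      replace (rsum (fun i => dirichlet (S i) z * a i) (S J) - fejer (S J) z * a (S J))
        with ((rsum (fun i => dirichlet (S i) z * a i) J - fejer J z * a J)
              + fejer (S J) z * (a J - a (S J))) by (unfold fejer; simpl; ring).
      eapply Rle_trans; [apply Rabs_triang|]. rewrite Rabs_mult.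
      assert (Hd := Hdec J). rewrite (Rabs_right (a J - a (S J))) by lra.
      assert (Hf := fejer_bound k z (S J) HJ).
      eapply Rle_trans; [apply Rplus_le_compat; [exact IH|]|].
      + apply Rmult_le_compat_r; [lra|exact Hf].
      + rewrite Rmult_comm, <- rsum_scal, <- rsum_plus. apply rsum_le. intros s _.
        assert (Hm := fejer_maj_nonneg s z).
        destruct (Nat.lt_trichotomy (2 ^ s) (S J)) as [Hs|[Hs|Hs]].
        * rewrite !chi_true by lia. nra.
        (* The threshold is reached exactly here: [a J] equals [/ INR (r + 2 ^ s)], so the
           telescoping sum starts without a gap. *)
        * rewrite (chi_false (2 ^ s <= J)%nat), chi_true by lia.
          rewrite Hs. fold (a J). nra.
        * rewrite !chi_false by lia. lra. }
  assert (Hk : (2 ^ k - 1 < 2 ^ k)%nat)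
    by (assert (2 ^ k <> 0)%nat by (apply Nat.pow_nonzero; lia); lia).
  specialize (H (2 ^ k - 1)%nat Hk). set (J := (2 ^ k - 1)%nat) in *.
  unfold tkernel. fold J. change (fun i => dirichlet (S i) z * / INR (r + S i))
    with (fun i => dirichlet (S i) z * a i).
  assert (Hf := fejer_bound k z J Hk). assert (Ha : 0 <= a J) by (destruct (Hdec J); lra).
  replace (rsum (fun i => dirichlet (S i) z * a i) J) with
    ((rsum (fun i => dirichlet (S i) z * a i) J - fejer J z * a J) + fejer J z * a J) by lra.
  eapply Rle_trans; [apply Rabs_triang|]. rewrite Rabs_mult, (Rabs_right (a J)) by lra.
  eapply Rle_trans; [apply Rplus_le_compat; [exact H|]|].
  - apply Rmult_le_compat_r; [exact Ha|exact Hf].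
  - rewrite Rmult_comm, <- rsum_scal, <- rsum_plus. apply rsum_le. intros s _.
    assert (Hm := fejer_maj_nonneg s z).
    assert (0 <= / INR (r + 2 ^ s)).
    { apply Rlt_le, Rinv_0_lt_compat, lt_0_INR.
      assert (2 ^ s <> 0)%nat by (apply Nat.pow_nonzero; lia). lia. }
    unfold chi. destruct excluded_middle_informative; nra.
Qed.

(** The summation variable is [i = n - k - 1], so that the first [r] terms of [nkernel (2 ^ k + r)]
    carry the weights of [nkernel r]. *)
Definition nkernel (n : nat) (z : digits) : R :=
  rsum (fun i => dirichlet (n - 1 - i) z * / INR (S i)) (n - 1).

Definition harm (n : nat) : R := rsum (fun i => / INR (S i)) n.

Lemma lsum_harm (n : nat) : lsum n = harm (n - 1).
Proof.
  unfold lsum, rsum_range, harm. replace (S (n - 1) - 1)%nat with (n - 1)%nat by lia.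
  reflexivity.
Qed.

(** Orders of at least $2^k$ are split by [dirichlet_pow2_add], lower ones are reflected; both
    release a copy of [D2 k], and the weights of these copies add up to $l_{2^k+r}$. *)
Lemma nkernel_rec (k r : nat) (z : digits) : (r < 2 ^ k)%nat ->
  nkernel (2 ^ k + r) z
  = lsum (2 ^ k + r) * D2 k z - wal (2 ^ k - 1) z * tkernel k r z + rad k z * nkernel r z.
Proof.
  intros Hr. unfold nkernel at 1. rewrite lsum_harm. unfold harm.
  replace (2 ^ k + r - 1)%nat with (r + (2 ^ k - 1))%nat by lia.
  rewrite !rsum_split.
  rewrite (rsum_ext _ (fun i => D2 k z * / INR (S i)
       + rad k z * (dirichlet (r - 1 - i) z * / INR (S i))) r).
  2:{ intros i Hi. replace (r + (2 ^ k - 1) - i)%nat with (2 ^ k + (r - 1 - i))%nat by lia.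
      rewrite dirichlet_pow2_add by lia. fold (D2 k z). ring. }
  rewrite rsum_plus, !rsum_scal.
  rewrite (rsum_ext _ (fun i => D2 k z * / INR (S (r + i))
       + (- wal (2 ^ k - 1) z) * (dirichlet (S i) z * / INR (r + S i))) (2 ^ k - 1)).
  2:{ intros i Hi. replace (r + (2 ^ k - 1) - (r + i))%nat with (2 ^ k - S i)%nat by lia.
      rewrite dirichlet_pow2_sub by lia. fold (D2 k z). rewrite <- Nat.add_succ_r. ring. }
  rewrite rsum_plus, !rsum_scal. fold (tkernel k r z).
  (* One summand more than in [nkernel r], namely the order 0, where the Dirichlet kernel
     vanishes. *)
  assert (E : rsum (fun i => dirichlet (r - 1 - i) z * / INR (S i)) r = nkernel r z).
  { unfold nkernel. destruct r as [|r]; [reflexivity|]. cbn [rsum].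
    replace (S r - 1)%nat with r by lia. rewrite Nat.sub_diag, dirichlet_0. ring. }
  rewrite E. ring.
Qed.

(** * Nörlund logarithmic kernels *)

Lemma pow2_nat_pos (k : nat) : (0 < 2 ^ k)%nat.
Proof. apply Nat.neq_0_lt_0, Nat.pow_nonzero. lia. Qed.

Lemma pow2_pos (k : nat) : 0 < 2 ^ k.
Proof. apply pow_lt. lra. Qed.

Lemma inv_INR_nonneg (n : nat) : 0 <= / INR (S n).
Proof. apply Rlt_le, Rinv_0_lt_compat, lt_0_INR. lia. Qed.

Lemma lsum_mono (a b : nat) : (a <= b)%nat -> lsum a <= lsum b.
Proof.
  intros H. rewrite !lsum_harm. apply rsum_mono; [lia|]. intros. apply inv_INR_nonneg.
Qed.

Lemma lsum_nonneg (a : nat) : 0 <= lsum a.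
Proof. rewrite lsum_harm. apply rsum_nonneg. intros. apply inv_INR_nonneg. Qed.

(** There are $2^{k+1}$ terms of size at most $2^{-k}$. This is the cost per digit of telescoping
    inside a block of ones. *)
Lemma lsum_block (k r : nat) : (2 ^ k <= r)%nat -> lsum (2 ^ S k + r) - lsum r <= 2.
Proof.
  intros H. assert (P := pow2_nat_pos k). rewrite !lsum_harm. unfold harm.
  replace (2 ^ S k + r - 1)%nat with (r - 1 + 2 ^ S k)%nat by lia. rewrite rsum_split.
  assert (B : rsum (fun i => / INR (S (r - 1 + i))) (2 ^ S k)
              <= rsum (fun _ => / INR (2 ^ k)) (2 ^ S k)).
  { apply rsum_le. intros i _. apply Rinv_le_contravar; [apply lt_0_INR; lia|].
    apply le_INR. lia. }
  rewrite rsum_const, !INR_pow2 in B. simpl pow in B.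
  assert (Q := pow2_pos k).
  replace (2 * 2 ^ k * / 2 ^ k) with 2 in B by (field; lra). simpl in *. lra.
Qed.

(** Every dyadic block of the harmonic series contributes at least 1/2. This trades $|n|$ for $l_n$
    in the final bound. *)
Lemma lsum_log (n : nat) : (1 <= n)%nat -> INR (Nat.log2 n) / 2 <= lsum n.
Proof.
  intros Hn. apply Rle_trans with (lsum (2 ^ Nat.log2 n)).
  2:{ apply lsum_mono. apply Nat.log2_spec. lia. }
  generalize (Nat.log2 n) as k. intros k. induction k as [|k IH].
  - simpl. assert (A := lsum_nonneg 1). lra.
  - rewrite lsum_harm in *. unfold harm in *. assert (P := pow2_nat_pos k).
    replace (2 ^ S k - 1)%nat with (2 ^ k - 1 + 2 ^ k)%nat by (simpl; lia).
    rewrite rsum_split.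
    assert (B : rsum (fun _ => / INR (2 ^ S k)) (2 ^ k)
                <= rsum (fun i => / INR (S (2 ^ k - 1 + i))) (2 ^ k)).
    { apply rsum_le. intros i Hi. apply Rinv_le_contravar; [apply lt_0_INR; lia|].
      apply le_INR. simpl. lia. }
    rewrite rsum_const, !INR_pow2 in B. simpl pow in B. assert (Q := pow2_pos k).
    replace (2 ^ k * / (2 * 2 ^ k)) with (/ 2) in B by (field; lra).
    rewrite S_INR. lra.
Qed.

Definition variation (n : nat) : R :=
  rsum (fun i => Rabs (INR (b2n (ndigit n (S i))) - INR (b2n (ndigit n (S (S i)))))
                 * lsum (n mod 2 ^ S i)) (Nat.log2 n).

Lemma cond_term_variation (n : nat) : cond_term n = / INR (Nat.log2 n) * variation n.
Proof.
  unfold cond_term, variation, rsum_range, nlog, ntrunc. f_equal.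
  replace (S (Nat.log2 n) - 1)%nat with (Nat.log2 n) by lia.
  apply rsum_ext. intros i _. simpl Nat.add. now rewrite Nat.sub_succ, Nat.sub_0_r.
Qed.

Lemma variation_term_nonneg (n i : nat) (a : R) : 0 <= Rabs a * lsum (n mod 2 ^ S i).
Proof. apply Rmult_le_pos; [apply Rabs_pos|apply lsum_nonneg]. Qed.

Lemma variation_nonneg (n : nat) : 0 <= variation n.
Proof. apply rsum_nonneg. intros. apply variation_term_nonneg. Qed.

Lemma log2_pow2_add (k r : nat) : (r < 2 ^ k)%nat -> Nat.log2 (2 ^ k + r) = k.
Proof. intros H. apply Nat.log2_unique; simpl; lia. Qed.

Lemma mod_pow2_add (k r i : nat) : (i <= k)%nat -> ((2 ^ k + r) mod 2 ^ i = r mod 2 ^ i)%nat.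
Proof.
  intros H. replace (2 ^ k)%nat with (2 ^ (k - i) * 2 ^ i)%nat
    by (rewrite <- Nat.pow_add_r; f_equal; lia).
  rewrite Nat.add_comm. apply Nat.Div0.mod_add.
Qed.

(** Prolonging the top block of ones moves its upper jump one place up, to a weight that is no
    smaller. *)
Lemma variation_block (k r : nat) :
  (2 ^ k <= r < 2 ^ S k)%nat -> variation r <= variation (2 ^ S k + r).
Proof.
  intros Hr. unfold variation. rewrite (log2_pow2_add (S k) r) by lia.
  replace (Nat.log2 r) with k by (symmetry; apply Nat.log2_unique; lia).
  destruct k as [|k].
  - cbn [rsum]. rewrite Rplus_0_l. apply variation_term_nonneg.
  - cbn [rsum].
    match goal with |- ?a + ?b <= ?c + ?d + ?e =>
      assert (H1 : a = c); [|assert (H2 : b <= e);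
      [|assert (H3 : 0 <= d) by apply variation_term_nonneg; lra]] end.
    + apply rsum_ext. intros i Hi. unfold ndigit.
      rewrite !testbit_pow2_add_low by lia. rewrite mod_pow2_add by lia. reflexivity.
    + unfold ndigit. rewrite (testbit_pow2_add_eq (S (S k)) r) by lia.
      rewrite (testbit_high (2 ^ S (S k) + r) (S (S (S k)))) by (simpl in *; lia).
      rewrite (testbit_high r (S (S k))) by lia.
      assert (Hb : Nat.testbit r (S k) = true).
      { replace r with (2 ^ S k + (r - 2 ^ S k))%nat by lia.
        apply testbit_pow2_add_eq. simpl in *. lia. }
      rewrite Hb, mod_pow2_add by lia. apply Rmult_le_compat_l; [apply Rabs_pos|].
      apply lsum_mono. rewrite (Nat.mod_small r (2 ^ S (S k))) by lia.
      apply Nat.Div0.mod_le.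
Qed.

(** A leading one above a zero creates a jump on either side, both of weight $l_r$. The gain $2l_r$
    pays for the top part of [nkernel r], which does not telescope in this case. *)
Lemma variation_gap (k r : nat) : (0 < r < 2 ^ k)%nat ->
  variation r + 2 * lsum r <= variation (2 ^ S k + r).
Proof.
  intros Hr. unfold variation at 2. rewrite (log2_pow2_add (S k) r) by (simpl; lia).
  assert (Hl : (Nat.log2 r < k)%nat) by (apply Nat.log2_lt_pow2; lia).
  destruct k as [|k]; [lia|]. cbn [rsum].
  match goal with |- _ <= ?c + ?d + ?e =>
    assert (H1 : variation r <= c); [|assert (H2 : d = lsum r); [|assert (H3 : e = lsum r);
    [|lra]]] end.
  - unfold variation.
    apply Rle_trans with (rsum (fun i =>
       Rabs (INR (b2n (ndigit (2 ^ S (S k) + r) (S i)))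
             - INR (b2n (ndigit (2 ^ S (S k) + r) (S (S i)))))
       * lsum ((2 ^ S (S k) + r) mod 2 ^ S i)) (Nat.log2 r)).
    + apply Req_le, rsum_ext. intros i Hi. unfold ndigit.
      rewrite !testbit_pow2_add_low by lia. rewrite mod_pow2_add by lia. reflexivity.
    + apply rsum_mono; [lia|]. intros. apply variation_term_nonneg.
  - unfold ndigit. rewrite (testbit_pow2_add_low (S (S k)) r (S k)) by lia.
    rewrite testbit_high by lia.
    rewrite testbit_pow2_add_eq by (simpl in *; lia).
    rewrite mod_pow2_add by lia. rewrite Nat.mod_small by lia.
    simpl. rewrite Rminus_0_l, Rabs_Ropp, Rabs_R1. lra.
  - unfold ndigit. rewrite testbit_pow2_add_eq by (simpl in *; lia).
    rewrite (testbit_high (2 ^ S (S k) + r) (S (S (S k)))) by (simpl in *; lia).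
    rewrite mod_pow2_add by lia. rewrite Nat.mod_small by (simpl in *; lia).
    simpl. rewrite Rminus_0_r, Rabs_R1. lra.
Qed.

(** Monotonicity in $|u|$ lets unimodular factors such as [rad] and [wal] be discarded. The intended
    instance is [kernel_norm x], the convolution of a weight with $|u|$ at the point [x]. *)
Record mseminorm (N : (digits -> R) -> R) : Prop := {
  msn_mono : forall u v, (forall z, Rabs (u z) <= Rabs (v z)) -> N u <= N v;
  msn_add : forall u v, N (fun z => u z + v z) <= N u + N v;
  msn_scal : forall a u, N (fun z => a * u z) <= Rabs a * N u }.

Lemma msn_zero (N : (digits -> R) -> R) : mseminorm N -> N (fun _ => 0) = 0.
Proof.
  intros HN. assert (A := msn_scal N HN 0 (fun _ => 0)).
  assert (B := msn_add N HN (fun _ => 0) (fun _ => 0)). cbv beta in *.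
  rewrite Rabs_R0 in A. rewrite Rplus_0_r in B. rewrite Rmult_0_l in A.
  replace (fun _ : digits => 0 * 0) with (fun _ : digits => 0) in A
    by (extensionality z; lra). lra.
Qed.

Lemma msn_nonneg (N : (digits -> R) -> R) (u : digits -> R) : mseminorm N -> 0 <= N u.
Proof.
  intros HN. rewrite <- (msn_zero N HN). apply (msn_mono N HN). intros z.
  rewrite Rabs_R0. apply Rabs_pos.
Qed.

Lemma msn_rsum (N : (digits -> R) -> R) (u : nat -> digits -> R) (n : nat) :
  mseminorm N -> N (fun z => rsum (fun i => u i z) n) <= rsum (fun i => N (u i)) n.
Proof.
  intros HN. induction n as [|n IH]; simpl.
  - rewrite msn_zero by assumption. lra.
  - eapply Rle_trans; [apply (msn_add N HN (fun z => rsum (fun i => u i z) n))|]. lra.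
Qed.

(** * Seminorm estimates for the logarithmic kernels *)

Section KernelBound.
Context (N : (digits -> R) -> R) (HN : mseminorm N) (M : nat) (Lam : R).
Context (HQ : forall s, (s <= M)%nat -> N (fejer_maj s) <= 2 ^ s * Lam).

Lemma seminorm_bound_nonneg : 0 <= Lam.
Proof.
  assert (A := HQ 0 ltac:(lia)). assert (B := msn_nonneg N (fejer_maj 0) HN).
  simpl in A. lra.
Qed.

Lemma seminorm_D2 (k : nat) : (k <= M)%nat -> N (D2 k) <= Lam.
Proof.
  intros Hk. assert (P := pow2_pos k).
  apply Rle_trans with (N (fun z => / 2 ^ k * fejer_maj k z)).
  - apply (msn_mono N HN). intros z. assert (A := D2_nonneg k z).
    assert (B := fejer_maj_nonneg k z). assert (C := D2_le_fejer_maj k z).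
    assert (0 < / 2 ^ k) by now apply Rinv_0_lt_compat.
    rewrite !Rabs_right; try nra.
    apply Rmult_le_reg_l with (2 ^ k); [assumption|].
    rewrite <- Rmult_assoc, Rinv_r by lra. lra.
  - eapply Rle_trans; [apply (msn_scal N HN)|].
    rewrite Rabs_right by (apply Rle_ge, Rlt_le, Rinv_0_lt_compat; assumption).
    apply Rmult_le_reg_l with (2 ^ k); [assumption|].
    rewrite <- Rmult_assoc, Rinv_r by lra. rewrite Rmult_1_l. now apply HQ.
Qed.

Lemma seminorm_tkernel_sum (k r : nat) : (k <= M)%nat ->
  N (tkernel k r) <= 2 * Lam * rsum (fun s => 2 ^ s * / INR (r + 2 ^ s)) k.
Proof.
  intros Hk.
  apply Rle_trans with (N (fun z => rsum (fun s => 2 * / INR (r + 2 ^ s) * fejer_maj s z) k)).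
  - apply (msn_mono N HN). intros z. eapply Rle_trans; [apply tkernel_bound|].
    eapply Rle_trans; [|apply Rle_abs]. apply Req_le, rsum_ext. intros; lra.
  - eapply Rle_trans; [apply (msn_rsum N (fun s z => 2 * / INR (r + 2 ^ s) * fejer_maj s z)); assumption|].
    rewrite <- rsum_scal. apply rsum_le. intros s Hs.
    eapply Rle_trans; [apply (msn_scal N HN)|].
    assert (P := pow2_nat_pos s).
    assert (0 < / INR (r + 2 ^ s)) by (apply Rinv_0_lt_compat, lt_0_INR; lia).
    rewrite Rabs_right by lra. assert (A := HQ s ltac:(lia)). nra.
Qed.

Lemma seminorm_tkernel_0 (k : nat) : (k <= M)%nat -> N (tkernel k 0) <= 2 * Lam * INR k.
Proof.
  intros Hk. eapply Rle_trans; [now apply seminorm_tkernel_sum|].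
  apply Rmult_le_compat_l; [assert (A := seminorm_bound_nonneg); lra|].
  rewrite (rsum_ext _ (fun _ => 1)); [rewrite rsum_const; lra|].
  intros s _. simpl Nat.add. rewrite INR_pow2. apply Rinv_r. assert (P := pow2_pos s). lra.
Qed.

Lemma rsum_pow2 (p : nat) : rsum (fun s => 2 ^ s) p = 2 ^ p - 1.
Proof. induction p as [|p IH]; simpl; [|rewrite IH]; lra. Qed.

(** Split at $s=|r|$: below, the weights $2^s/(r+2^s)\le 2^{s-|r|}$ form a geometric series of sum
    at most 1; above, each is at most 1. The cost is thus the distance between successive ones of
    the order, and these distances add up to at most its logarithm. *)
Lemma seminorm_tkernel (k r : nat) : (k <= M)%nat -> (0 < r < 2 ^ k)%nat ->
  N (tkernel k r) <= 2 * Lam * (1 + INR (k - Nat.log2 r)).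
Proof.
  intros Hk Hr. eapply Rle_trans; [now apply seminorm_tkernel_sum|].
  apply Rmult_le_compat_l; [assert (A := seminorm_bound_nonneg); lra|].
  assert (Hp : (Nat.log2 r < k)%nat) by (apply Nat.log2_lt_pow2; lia).
  assert (Hp2 := proj1 (Nat.log2_spec r ltac:(lia))).
  set (p := Nat.log2 r) in *.
  replace k with (p + (k - p))%nat at 1 by lia. rewrite rsum_split.
  apply Rplus_le_compat.
  - apply Rle_trans with (rsum (fun s => / 2 ^ p * 2 ^ s) p).
    + apply rsum_le. intros s _. rewrite Rmult_comm.
      apply Rmult_le_compat_r; [apply pow_le; lra|].
      apply Rinv_le_contravar; [apply pow2_pos|]. rewrite <- INR_pow2. apply le_INR. lia.
    + rewrite rsum_scal, rsum_pow2. assert (P := pow2_pos p).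
      apply Rmult_le_reg_l with (2 ^ p); [assumption|].
      rewrite <- Rmult_assoc, Rinv_r by lra. lra.
  - rewrite <- (Rmult_1_r (INR (k - p))), <- rsum_const.
    apply rsum_le. intros s _. rewrite <- INR_pow2.
    assert (P := pow2_nat_pos (p + s)).
    apply Rmult_le_reg_r with (INR (r + 2 ^ (p + s))); [apply lt_0_INR; lia|].
    rewrite Rmult_assoc, Rinv_l by (apply not_0_INR; lia).
    rewrite Rmult_1_r, Rmult_1_l. apply le_INR. lia.
Qed.

Definition nkernel_rest (n : nat) (z : digits) : R :=
  nkernel n z - lsum n * D2 (S (Nat.log2 n)) z.

(* In a block of consecutive ones the top parts [l_n D_(2^(|n|+1))] telescope, which is
   why they are split off before estimating. *)
Lemma seminorm_nkernel_rest : forall n, (0 < n < 2 ^ M)%nat ->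
  N (nkernel_rest n) <= Lam * (6 * INR (Nat.log2 n) + variation n + lsum n).
Proof.
  assert (HL := seminorm_bound_nonneg).
  intros n. induction n as [n IH] using lt_wf_ind. intros Hn.
  assert (Hk : (Nat.log2 n < M)%nat) by (apply Nat.log2_lt_pow2; lia).
  assert (Hk2 := Nat.log2_spec n ltac:(lia)).
  set (k := Nat.log2 n) in *. set (r := (n - 2 ^ k)%nat).
  assert (Hnr : n = (2 ^ k + r)%nat) by (unfold r; lia).
  assert (Hr : (r < 2 ^ k)%nat) by (simpl in Hk2; lia).
  (* By [D2_S] the term [lsum n * D2 k z] of the recursion cancels. What remains has the factor
     [rad k z], ready to meet the top part of [nkernel r] when $|r|=k-1$. *)
  assert (Hrest : forall z, nkernel_rest n z
     = - (rad k z * (lsum n * D2 k z)) - wal (2 ^ k - 1) z * tkernel k r z + rad k z * nkernel r z).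
  { intros z. unfold nkernel_rest. fold k. rewrite D2_S. rewrite Hnr at 1.
    rewrite nkernel_rec by assumption. rewrite <- Hnr. ring. }
  assert (Hln := lsum_nonneg n). assert (Hlr := lsum_nonneg r).
  assert (HD : forall a i, (i <= M)%nat -> 0 <= a -> N (fun z => a * D2 i z) <= a * Lam).
  { intros a i Hi Ha. eapply Rle_trans; [apply (msn_scal N HN)|].
    rewrite Rabs_right by lra. apply Rmult_le_compat_l; [assumption|]. now apply seminorm_D2. }
  assert (Hpn : forall u v w t : R, Rabs u <= Rabs v -> Rabs w <= Rabs t ->
            Rabs (u + w) <= Rabs v + Rabs t).
  { intros u v w t H1 H2. eapply Rle_trans; [apply Rabs_triang|]. lra. }
  assert (Habs : forall u w, 0 <= w -> Rabs u <= w -> Rabs u <= Rabs w).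
  { intros u w H1 H2. rewrite (Rabs_right w); lra. }
  destruct (Nat.eq_dec r 0) as [Hr0|Hr0].
  - apply Rle_trans with (N (fun z => lsum n * D2 k z + Rabs (tkernel k 0 z))).
    + apply (msn_mono N HN). intros z. rewrite Hrest, Hr0.
      change (nkernel 0 z) with 0. assert (A := D2_nonneg k z).
      assert (B := Rabs_pos (tkernel k 0 z)).
      apply Habs; [nra|]. rewrite Rmult_0_r, Rplus_0_r.
      eapply Rle_trans; [apply Rabs_triang|]. rewrite !Rabs_Ropp, !Rabs_mult, rad_abs, wal_abs.
      rewrite (Rabs_right (lsum n)), (Rabs_right (D2 k z)) by lra. lra.
    + eapply Rle_trans; [apply (msn_add N HN)|].
      assert (A := HD (lsum n) k ltac:(lia) Hln).
      assert (B : N (fun z => Rabs (tkernel k 0 z)) <= N (tkernel k 0)).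
      { apply (msn_mono N HN). intros z. rewrite Rabs_Rabsolu. lra. }
      assert (C := seminorm_tkernel_0 k ltac:(lia)).
      assert (E := variation_nonneg n). assert (F := pos_INR k). nra.
  - destruct k as [|k]; [simpl in Hr; lia|].
    assert (Hrn : (r < n)%nat) by (rewrite Hnr; assert (P := pow2_nat_pos (S k)); lia).
    specialize (IH r Hrn ltac:(lia)).
    assert (Ht := seminorm_tkernel (S k) r ltac:(lia) ltac:(lia)).
    assert (HtA : N (fun z => Rabs (tkernel (S k) r z)) <= N (tkernel (S k) r)).
    { apply (msn_mono N HN). intros z. rewrite Rabs_Rabsolu. lra. }
    assert (HrA : N (fun z => Rabs (nkernel_rest r z)) <= N (nkernel_rest r)).
    { apply (msn_mono N HN). intros z. rewrite Rabs_Rabsolu. lra. }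
    assert (Hmono : lsum r <= lsum n) by (apply lsum_mono; lia).
    destruct (Nat.le_gt_cases (2 ^ k) r) as [Hblock|Hgap].
    + assert (Hlog : Nat.log2 r = k) by (apply Nat.log2_unique; lia).
      assert (Hb : lsum n - lsum r <= 2) by (rewrite Hnr; now apply lsum_block).
      assert (Hv : variation r <= variation n)
        by (rewrite Hnr; apply variation_block; lia).
      rewrite Hlog in *. replace (S k - k)%nat with 1%nat in Ht by lia.
      apply Rle_trans with (N (fun z => (2 * D2 (S k) z + Rabs (tkernel (S k) r z))
                                        + Rabs (nkernel_rest r z))).
      * apply (msn_mono N HN). intros z. rewrite Hrest.
        assert (A := D2_nonneg (S k) z). assert (B := Rabs_pos (tkernel (S k) r z)).
        assert (C := Rabs_pos (nkernel_rest r z)).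
        apply Habs; [nra|].
        replace (nkernel r z) with (nkernel_rest r z + lsum r * D2 (S k) z)
          by (unfold nkernel_rest; rewrite Hlog; ring).
        replace (- (rad (S k) z * (lsum n * D2 (S k) z))
                 - wal (2 ^ S k - 1) z * tkernel (S k) r z
                 + rad (S k) z * (nkernel_rest r z + lsum r * D2 (S k) z))
          with (- (rad (S k) z * ((lsum n - lsum r) * D2 (S k) z))
                + - (wal (2 ^ S k - 1) z * tkernel (S k) r z)
                + rad (S k) z * nkernel_rest r z) by ring.
        eapply Rle_trans; [apply Rabs_triang|]. rewrite Rabs_mult, rad_abs, Rmult_1_l.
        apply Rplus_le_compat_r.
        eapply Rle_trans; [apply Rabs_triang|].
        rewrite !Rabs_Ropp, !Rabs_mult, rad_abs, wal_abs, !Rmult_1_l.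
        apply Rplus_le_compat_r.
        rewrite (Rabs_right (lsum n - lsum r)), (Rabs_right (D2 (S k) z)) by lra.
        apply Rmult_le_compat_r; assumption.
      * eapply Rle_trans; [apply (msn_add N HN)|].
        eapply Rle_trans; [apply Rplus_le_compat_r, (msn_add N HN)|].
        (* [2 * Lam] from the telescoped top parts and [4 * Lam] from [tkernel]: the origin of the
           constant 6 per digit. *)
        assert (A := HD 2 (S k) ltac:(lia) ltac:(lra)).
        rewrite (S_INR k). simpl INR in Ht. nra.
    + assert (Hlog : (Nat.log2 r < k)%nat) by (apply Nat.log2_lt_pow2; lia).
      assert (Hv : variation r + 2 * lsum r <= variation n)
        by (rewrite Hnr; apply variation_gap; lia).
      apply Rle_trans with (N (fun z => (lsum n * D2 (S k) z + Rabs (tkernel (S k) r z))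
                  + (Rabs (nkernel_rest r z) + lsum r * D2 (S (Nat.log2 r)) z))).
      * apply (msn_mono N HN). intros z. rewrite Hrest.
        assert (A := D2_nonneg (S k) z). assert (B := Rabs_pos (tkernel (S k) r z)).
        assert (C := Rabs_pos (nkernel_rest r z)). assert (E := D2_nonneg (S (Nat.log2 r)) z).
        apply Habs; [nra|].
        replace (nkernel r z) with (nkernel_rest r z + lsum r * D2 (S (Nat.log2 r)) z)
          by (unfold nkernel_rest; ring).
        unfold Rminus.
        eapply Rle_trans; [apply Rabs_triang|]. apply Rplus_le_compat.
        -- eapply Rle_trans; [apply Rabs_triang|].
           rewrite !Rabs_Ropp, !Rabs_mult, rad_abs, wal_abs, !Rmult_1_l.
           rewrite (Rabs_right (lsum n)), (Rabs_right (D2 (S k) z)) by lra. lra.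
        -- rewrite Rabs_mult, rad_abs, Rmult_1_l.
           eapply Rle_trans; [apply Rabs_triang|]. rewrite Rabs_mult.
           rewrite (Rabs_right (lsum r)), (Rabs_right (D2 (S (Nat.log2 r)) z)) by lra. lra.
      * eapply Rle_trans; [apply (msn_add N HN)|].
        eapply Rle_trans; [apply Rplus_le_compat; apply (msn_add N HN)|].
        assert (A := HD (lsum n) (S k) ltac:(lia) Hln).
        assert (B := HD (lsum r) (S (Nat.log2 r)) ltac:(lia) Hlr).
        rewrite minus_INR in Ht by lia.
        (* Makes $2(1+d)\le 6d$ for the distance $d$ between the two leading ones. *)
        assert (C : 1 <= INR (S k) - INR (Nat.log2 r)).
        { rewrite <- minus_INR by lia. apply (le_INR 1). lia. }
        nra.
Qed.

Lemma seminorm_nkernel (n : nat) : (0 < n < 2 ^ M)%nat ->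
  N (nkernel n) <= Lam * (6 * INR (Nat.log2 n) + variation n + 2 * lsum n).
Proof.
  intros Hn.
  assert (Hk : (Nat.log2 n < M)%nat) by (apply Nat.log2_lt_pow2; lia).
  replace (nkernel n) with (fun z => nkernel_rest n z + lsum n * D2 (S (Nat.log2 n)) z)
    by (extensionality z; unfold nkernel_rest; ring).
  eapply Rle_trans; [apply (msn_add N HN)|].
  assert (A := seminorm_nkernel_rest n Hn).
  assert (B := msn_scal N HN (lsum n) (D2 (S (Nat.log2 n)))).
  assert (C := seminorm_D2 (S (Nat.log2 n)) ltac:(lia)). assert (E := lsum_nonneg n).
  rewrite (Rabs_right (lsum n)) in B by lra. nra.
Qed.
End KernelBound.

(** Since $|n|\le 2l_n$, the bound $6|n|+|C||n|+2l_n$ is at most $(14+2|C|)l_n$. *)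
Lemma seminorm_nkernel_cond (N : (digits -> R) -> R) (M n : nat) (Lam C : R) :
  mseminorm N -> (forall s, (s <= M)%nat -> N (fejer_maj s) <= 2 ^ s * Lam) ->
  (2 <= n < 2 ^ M)%nat -> cond_term n <= C ->
  N (nkernel n) <= Lam * (14 + 2 * Rabs C) * lsum n.
Proof.
  intros HN HQ Hn HC.
  assert (A := seminorm_nkernel N HN M Lam HQ n ltac:(lia)).
  assert (B := lsum_log n ltac:(lia)). assert (HL := seminorm_bound_nonneg N HN M Lam HQ).
  assert (Hk : (1 <= Nat.log2 n)%nat) by (apply Nat.log2_le_pow2; simpl; lia).
  assert (Hk' : 1 <= INR (Nat.log2 n)) by (apply (le_INR 1); lia).
  rewrite cond_term_variation in HC.
  assert (Hv : variation n <= Rabs C * INR (Nat.log2 n)).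
  { apply Rle_trans with (C * INR (Nat.log2 n)).
    - apply Rmult_le_reg_l with (/ INR (Nat.log2 n)); [apply Rinv_0_lt_compat; lra|].
      eapply Rle_trans; [exact HC|]. apply Req_le. field. lra.
    - apply Rmult_le_compat_r; [lra|apply Rle_abs]. }
  assert (HC0 := Rabs_pos C). eapply Rle_trans; [exact A|].
  rewrite Rmult_assoc. apply Rmult_le_compat_l; [assumption|]. nra.
Qed.

(** * The weak type inequality *)

Lemma rsum_chi_exclusive (P : nat -> Prop) (K : nat) :
  (forall a b, P a -> P b -> a = b) ->
  rsum (fun a => chi (P a)) K = chi (exists a, (a < K)%nat /\ P a).
Proof.
  intros HP. induction K as [|K IH]; simpl.
  - rewrite chi_false; [reflexivity|]. intros [a [Ha _]]. lia.
  - rewrite IH. destruct (classic (P K)) as [H|H].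
    + rewrite (chi_true (P K)) by assumption. rewrite chi_false, chi_true; [lra| |].
      * exists K. split; [lia|assumption].
      * intros [a [Ha Pa]]. assert (a = K) by now apply HP. lia.
    + rewrite (chi_false (P K)) by assumption. rewrite Rplus_0_r.
      apply Rle_antisym; apply chi_mono; intros [a [Ha Pa]]; exists a; split; try assumption.
      * lia.
      * destruct (Nat.eq_dec a K) as [->|]; [contradiction|lia].
Qed.

Section WeakType.
Context (M : nat) (phi : digits -> R) (Hphi : forall z, 0 <= phi z).
Context (lam : R) (Hlam : 0 < lam).

(** For [s <= M], the conditional expectation of [phi] on the cells of length $2^{-s}$. *)
Definition dyadic_avg (s : nat) (x : digits) : R := mean M (fun y => phi y * D2 s (sxor x y)).

(** The Calderón-Zygmund stopping time: the level-[a] cell of [x] is maximal among those with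
    average above [lam]. *)
Definition stop (a : nat) (x : digits) : Prop :=
  lam < dyadic_avg a x /\ forall b, (b < a)%nat -> dyadic_avg b x <= lam.

Lemma dyadic_avg_depends (s : nat) : depends s (dyadic_avg s).
Proof.
  intros x x' H. apply mean_ext. intros y _. f_equal. apply D2_depends.
  now apply agree_sxor.
Qed.

Lemma dyadic_avg_nonneg (s : nat) (x : digits) : 0 <= dyadic_avg s x.
Proof. apply mean_nonneg. intros. apply Rmult_le_pos; [apply Hphi|apply D2_nonneg]. Qed.

Lemma stop_agree (a : nat) (x y : digits) : agree a x y -> stop a x -> stop a y.
Proof.
  intros H [H1 H2]. split.
  - now rewrite <- (dyadic_avg_depends a x y H).
  - intros b Hb. rewrite <- (dyadic_avg_depends b x y); [now apply H2|].
    intros k Hk. apply H. lia.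
Qed.

Lemma stop_unique (a b : nat) (x : digits) : stop a x -> stop b x -> a = b.
Proof.
  intros [A1 A2] [B1 B2]. destruct (Nat.lt_trichotomy a b) as [H|[H|H]]; [|assumption|].
  - specialize (B2 a H). lra.
  - specialize (A2 b H). lra.
Qed.

Lemma stop_exists (s : nat) (x : digits) :
  lam < dyadic_avg s x -> exists a, (a <= s)%nat /\ stop a x.
Proof.
  induction s as [s IH] using lt_wf_ind. intros H.
  destruct (classic (exists b, (b < s)%nat /\ lam < dyadic_avg b x)) as [[b [Hb Hlt]]|Hno].
  - destruct (IH b Hb Hlt) as [a [Ha Hs]]. exists a. split; [lia|assumption].
  - exists s. split; [lia|]. split; [assumption|]. intros b Hb.
    apply Rnot_lt_le. intros Hlt. apply Hno. now exists b.
Qed.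

(** [stop a] is a union of level-[a] cells, so its indicator passes from [x] to [y] under the kernel
    [D2 a], which then integrates to 1. *)
Lemma stop_mean (a : nat) : (a <= M)%nat ->
  mean M (fun x => chi (stop a x) * dyadic_avg a x) = mean M (fun y => chi (stop a y) * phi y).
Proof.
  intros Ha.
  rewrite (mean_ext M _ (fun x => mean M (fun y => chi (stop a y) * phi y * D2 a (sxor x y)))).
  - rewrite mean_swap. apply mean_ext. intros y Hy.
    rewrite mean_scal, mean_D2 by assumption. lra.
  - intros x _. unfold dyadic_avg. rewrite <- mean_scal. apply mean_ext. intros y _.
    destruct (classic (agree a x y)) as [H|H].
    + replace (chi (stop a x)) with (chi (stop a y)); [lra|].
      apply Rle_antisym; apply chi_mono; apply stop_agree; [now apply agree_sym|assumption].
    + rewrite D2_not_agree by assumption. lra.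
Qed.

Lemma stop_mean_total :
  rsum (fun a => mean M (fun x => chi (stop a x) * dyadic_avg a x)) (S M) <= mean M phi.
Proof.
  rewrite (rsum_ext _ (fun a => mean M (fun y => chi (stop a y) * phi y)))
    by (intros; apply stop_mean; lia).
  rewrite <- mean_rsum. apply mean_le. intros y _.
  rewrite (rsum_ext _ (fun a => phi y * chi (stop a y))) by (intros; lra).
  rewrite rsum_scal, rsum_chi_exclusive by (intros a b; apply stop_unique).
  assert (A := chi_bounds (exists a, (a < S M)%nat /\ stop a y)).
  assert (B := Hphi y). nra.
Qed.

Definition stopped (x : digits) : Prop := exists a, (a < S M)%nat /\ stop a x.

Lemma stopped_measure : lam * mean M (fun x => chi (stopped x)) <= mean M phi.
Proof.
  eapply Rle_trans; [|apply stop_mean_total]. rewrite <- mean_rsum, <- mean_scal.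
  apply mean_le. intros x _. unfold stopped.
  rewrite <- rsum_chi_exclusive by (intros a b; apply stop_unique).
  rewrite <- rsum_scal. apply rsum_le. intros a _.
  unfold chi. destruct excluded_middle_informative as [[H _]|_]; lra.
Qed.

(** Influence of the stopped cells on their reflections: flipping digit [l] carries [x] into a cell
    stopped at level [a], and $2^{l-a}$ is the weight left by [dyadic_avg_growth] after division by
    $2^s$. The result is independent of $s$, hence dominates a supremum over $s$. *)
Definition bad_part (x : digits) : R :=
  rsum (fun a => rsum (fun l => chi (l < a)%nat * (2 ^ l * / 2 ^ a)
     * (chi (stop a (flip l x)) * dyadic_avg a (flip l x))) M) (S M).

Lemma stop_avg_nonneg (a : nat) (x : digits) : 0 <= chi (stop a x) * dyadic_avg a x.
Proof. apply Rmult_le_pos; [apply chi_bounds|apply dyadic_avg_nonneg]. Qed.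

Lemma flip_weight_nonneg (l a : nat) : 0 <= chi (l < a)%nat * (2 ^ l * / 2 ^ a).
Proof.
  apply Rmult_le_pos; [apply chi_bounds|]. apply Rmult_le_pos; [apply Rlt_le, pow2_pos|].
  apply Rlt_le, Rinv_0_lt_compat, pow2_pos.
Qed.

(** Flips preserve [mean], and $\sum_{l<a}2^{l-a}<1$. *)
Lemma bad_part_mean : mean M bad_part <= mean M phi.
Proof.
  eapply Rle_trans; [|apply stop_mean_total]. unfold bad_part.
  rewrite (mean_rsum M (S M)). apply rsum_le. intros a Ha. rewrite (mean_rsum M M).
  rewrite (rsum_ext _ (fun l => mean M (fun x => chi (stop a x) * dyadic_avg a x)
      * (chi (l < a)%nat * (2 ^ l * / 2 ^ a)))).
  - rewrite rsum_scal. set (X := mean M _).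
    assert (HX : 0 <= X) by (apply mean_nonneg; intros; apply stop_avg_nonneg).
    assert (Hw : rsum (fun l => chi (l < a)%nat * (2 ^ l * / 2 ^ a)) M <= 1).
    { eapply Rle_trans; [apply (rsum_support _ a)|].
      - intros l. apply flip_weight_nonneg.
      - intros l Hl. rewrite chi_false by lia. lra.
      - rewrite (rsum_ext _ (fun l => / 2 ^ a * 2 ^ l)).
        + rewrite rsum_scal, rsum_pow2. assert (P := pow2_pos a).
          apply Rmult_le_reg_l with (2 ^ a); [assumption|].
          rewrite <- Rmult_assoc, Rinv_r by lra. lra.
        + intros l Hl. rewrite chi_true by assumption. lra. }
    nra.
  - intros l Hl. rewrite mean_scal.
    rewrite (mean_flip M l (fun x => chi (stop a x) * dyadic_avg a x)) by assumption. lra.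
Qed.

Definition maj_op (s : nat) (x : digits) : R := mean M (fun y => phi y * fejer_maj s (sxor x y)).

Lemma maj_op_avg (s : nat) (x : digits) :
  maj_op s x = 2 ^ s * dyadic_avg s x + rsum (fun l => 2 ^ l * dyadic_avg s (flip l x)) s.
Proof.
  unfold maj_op, dyadic_avg, fejer_maj.
  rewrite (rsum_ext _ (fun l => mean M (fun y => 2 ^ l * (phi y * D2 s (sxor (flip l x) y)))))
    by (intros; symmetry; apply mean_scal).
  rewrite <- mean_scal, <- mean_rsum, <- mean_plus. apply mean_ext. intros y _.
  rewrite Rmult_plus_distr_l, <- rsum_scal. f_equal; [ring|].
  apply rsum_ext. intros l _. rewrite flip_sxor. ring.
Qed.

Lemma dyadic_avg_growth (a s : nat) (y : digits) : (a <= s)%nat ->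
  dyadic_avg s y <= 2 ^ s * (/ 2 ^ a * dyadic_avg a y).
Proof.
  intros H. unfold dyadic_avg. rewrite <- !mean_scal. apply mean_le. intros t _.
  assert (A := D2_le a s (sxor y t) H). assert (B := Hphi t).
  assert (P := pow2_pos s). unfold Rdiv in A.
  assert (E : D2 s (sxor y t) <= 2 ^ s * (D2 a (sxor y t) * / 2 ^ a)).
  { apply Rmult_le_reg_r with (/ 2 ^ s); [now apply Rinv_0_lt_compat|].
    eapply Rle_trans; [exact A|]. apply Req_le.
    assert (Q := pow2_pos a). field. lra. }
  nra.
Qed.

(** The main term and the flips with average at most [lam] give the two copies of [lam]. Any other
    flip is stopped at some level $a\le s$, and $a>l$, since otherwise [x] would share the stopped
    cell. *)
Lemma maj_op_off_stopped (s : nat) (x : digits) :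
  (s <= M)%nat -> ~ stopped x -> maj_op s x <= 2 ^ s * (2 * lam + bad_part x).
Proof.
  intros Hs Hx. rewrite maj_op_avg. assert (P := pow2_pos s).
  assert (H1 : dyadic_avg s x <= lam).
  { apply Rnot_lt_le. intros H. destruct (stop_exists s x H) as [a [Ha Hst]].
    apply Hx. exists a. split; [lia|assumption]. }
  set (term := fun l a => chi (l < a)%nat * (2 ^ l * / 2 ^ a)
     * (chi (stop a (flip l x)) * dyadic_avg a (flip l x))).
  assert (Hterm : forall l a, 0 <= term l a).
  { intros l a. apply Rmult_le_pos; [apply flip_weight_nonneg|apply stop_avg_nonneg]. }
  assert (H2 : rsum (fun l => 2 ^ l * dyadic_avg s (flip l x)) s
     <= rsum (fun l => lam * 2 ^ l + 2 ^ s * rsum (term l) (S M)) s).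
  { apply rsum_le. intros l Hl. assert (Pl := pow2_pos l).
    assert (T0 : 0 <= rsum (term l) (S M)) by (apply rsum_nonneg; auto).
    destruct (Rle_lt_dec (dyadic_avg s (flip l x)) lam) as [Hle|Hgt]; [nra|].
    destruct (stop_exists s _ Hgt) as [a [Ha Hst]].
    assert (Hla : (l < a)%nat).
    { apply Nat.nle_gt. intros Hal. apply Hx. exists a. split; [lia|].
      apply stop_agree with (flip l x); [now apply agree_flip|assumption]. }
    assert (T1 : term l a <= rsum (term l) (S M)) by (apply rsum_single; [auto|lia]).
    unfold term in T1 at 1. rewrite !chi_true in T1 by assumption.
    assert (G := dyadic_avg_growth a s (flip l x) Ha). nra. }
  rewrite rsum_plus, !rsum_scal, rsum_pow2 in H2.
  assert (H3 : rsum (fun l => rsum (term l) (S M)) s <= bad_part x).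
  { unfold bad_part. rewrite rsum_swap. apply rsum_le. intros a _.
    apply (rsum_mono (fun l => term l a)); auto. }
  nra.
Qed.

(** The threshold exceeds [2 * lam] by the room left for [bad_part]. One copy of the mean pays for
    the stopped set, the other for Chebyshev's inequality applied to [bad_part]. *)
Lemma weak_type :
  mean M (fun x => chi (~ forall s, (s <= M)%nat -> maj_op s x <= 2 ^ s * (3 * lam)))
  <= 2 * mean M phi / lam.
Proof.
  assert (A := stopped_measure). assert (B := bad_part_mean).
  apply Rmult_le_reg_l with lam; [assumption|].
  replace (lam * (2 * mean M phi / lam)) with (mean M phi + mean M phi) by (field; lra).
  eapply Rle_trans; [|apply Rplus_le_compat; [exact A|exact B]].
  rewrite <- !mean_scal, <- mean_plus. apply mean_le. intros x _.
  assert (B0 : 0 <= bad_part x).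
  { apply rsum_nonneg. intros a _. apply rsum_nonneg. intros l _.
    apply Rmult_le_pos; [apply flip_weight_nonneg|apply stop_avg_nonneg]. }
  destruct (classic (stopped x)) as [H|H].
  - rewrite (chi_true (stopped x)) by assumption.
    assert (C := chi_bounds (~ forall s, (s <= M)%nat -> maj_op s x <= 2 ^ s * (3 * lam))). nra.
  - rewrite (chi_false (stopped x)) by assumption.
    destruct (Rle_lt_dec (bad_part x) lam) as [Hle|Hgt].
    + rewrite chi_false; [lra|]. intros Hn. apply Hn. intros s Hs.
      eapply Rle_trans; [now apply maj_op_off_stopped|].
      apply Rmult_le_compat_l; [apply Rlt_le, pow2_pos|lra].
    + assert (C := chi_bounds (~ forall s, (s <= M)%nat -> maj_op s x <= 2 ^ s * (3 * lam))). nra.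
Qed.

Definition kernel_norm (x : digits) (u : digits -> R) : R :=
  mean M (fun y => phi y * Rabs (u (sxor x y))).

Lemma kernel_norm_mseminorm (x : digits) : mseminorm (kernel_norm x).
Proof.
  unfold kernel_norm. split.
  - intros u v H. apply mean_le. intros y _. apply Rmult_le_compat_l; [apply Hphi|apply H].
  - intros u v. rewrite <- mean_plus. apply mean_le. intros y _.
    assert (A := Rabs_triang (u (sxor x y)) (v (sxor x y))). assert (B := Hphi y). nra.
  - intros a u. rewrite <- mean_scal. apply Req_le, mean_ext. intros y _.
    rewrite Rabs_mult. ring.
Qed.

Lemma kernel_norm_fejer_maj (s : nat) (x : digits) : kernel_norm x (fejer_maj s) = maj_op s x.
Proof.
  apply mean_ext. intros y _. rewrite Rabs_right; [reflexivity|].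
  apply Rle_ge, fejer_maj_nonneg.
Qed.

Lemma kernel_norm_nkernel (C : R) (n : nat) (x : digits) :
  (forall s, (s <= M)%nat -> maj_op s x <= 2 ^ s * (3 * lam)) ->
  (2 <= n < 2 ^ M)%nat -> cond_term n <= C ->
  kernel_norm x (nkernel n) <= 3 * lam * (14 + 2 * Rabs C) * lsum n.
Proof.
  intros H Hn HC. apply seminorm_nkernel_cond with M; try assumption.
  - apply kernel_norm_mseminorm.
  - intros s Hs. rewrite kernel_norm_fejer_maj. now apply H.
Qed.
End WeakType.

(** * Covers by countably many intervals *)

(** The matrix of [null_set] with its bound exposed: [null_set N] unfolds to [covered N eps] for all
    positive [eps]. *)
Definition covered (N : R -> Prop) (c : R) : Prop :=
  exists a b : nat -> R,
    (forall k, a k <= b k) /\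
    (forall x, N x -> exists k, a k <= x <= b k) /\
    (forall K, rsum (fun k => b k - a k) K <= c).

Lemma covered_sub (N N' : R -> Prop) (c c' : R) :
  (forall x, N x -> N' x) -> c' <= c -> covered N' c' -> covered N c.
Proof.
  intros HN Hc [a [b [H1 [H2 H3]]]]. exists a, b. repeat split; auto.
  intros K. specialize (H3 K). lra.
Qed.

(** Both components of the pair coded by [k] are at most [k], so the first [K] pairs lie, without
    repetition, in a square of side [K]. *)
Lemma rsum_cantor (v : nat -> nat -> R) (K : nat) : (forall i j, 0 <= v i j) ->
  rsum (fun k => v (fst (of_nat k)) (snd (of_nat k))) K <= rsum (fun i => rsum (v i) K) K.
Proof.
  intros Hv.
  apply Rle_trans with (rsum (fun k => rsum (fun i =>
      rsum (fun j => v i j * chi (to_nat (i, j) = k)) K) K) K).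
  - apply rsum_le. intros k Hk. destruct (of_nat k) as [i j] eqn:E. simpl.
    assert (Ek : to_nat (i, j) = k) by (rewrite <- E; apply cancel_to_of).
    assert (B := to_nat_non_decreasing i j). rewrite Ek in B.
    assert (P : forall i j, 0 <= v i j * chi (to_nat (i, j) = k)).
    { intros. apply Rmult_le_pos; [apply Hv|apply chi_bounds]. }
    apply Rle_trans with (rsum (fun j => v i j * chi (to_nat (i, j) = k)) K).
    + apply Rle_trans with (v i j * chi (to_nat (i, j) = k)).
      * rewrite chi_true by assumption. lra.
      * apply (rsum_single (fun j => v i j * chi (to_nat (i, j) = k))); [auto|lia].
    + apply (rsum_single (fun i => rsum (fun j => v i j * chi (to_nat (i, j) = k)) K)); [|lia].
      intros. apply rsum_nonneg. auto.
  - rewrite rsum_swap. apply rsum_le. intros i _. rewrite rsum_swap. apply rsum_le.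
    intros j _. rewrite rsum_scal, rsum_chi_exclusive by (intros; congruence).
    assert (A := chi_bounds (exists a, (a < K)%nat /\ to_nat (i, j) = a)).
    specialize (Hv i j). nra.
Qed.

Lemma covered_double (N : R -> Prop) (c : R) (a b : nat -> nat -> R) :
  (forall i j, a i j <= b i j) ->
  (forall x, N x -> exists i j, a i j <= x <= b i j) ->
  (forall K, rsum (fun i => rsum (fun j => b i j - a i j) K) K <= c) ->
  covered N c.
Proof.
  intros H1 H2 H3.
  exists (fun k => a (fst (of_nat k)) (snd (of_nat k))),
         (fun k => b (fst (of_nat k)) (snd (of_nat k))).
  split; [|split].
  - intros k. apply H1.
  - intros x Hx. destruct (H2 x Hx) as [i [j Hij]]. exists (to_nat (i, j)).
    now rewrite cancel_of_to.
  - intros K. eapply Rle_trans; [|exact (H3 K)].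
    apply (rsum_cantor (fun i j => b i j - a i j)). intros i j. specialize (H1 i j). lra.
Qed.

Lemma covered_union (N : nat -> R -> Prop) (c : nat -> R) (C : R) :
  (forall i, covered (N i) (c i)) -> (forall K, rsum c K <= C) ->
  covered (fun x => exists i, N i x) C.
Proof.
  intros H HC.
  set (a := fun i => proj1_sig (constructive_indefinite_description _ (H i))).
  assert (Ha : forall i, exists b, (forall k, a i k <= b k) /\
    (forall x, N i x -> exists k, a i k <= x <= b k) /\
    (forall K, rsum (fun k => b k - a i k) K <= c i)).
  { intros i. exact (proj2_sig (constructive_indefinite_description _ (H i))). }
  set (b := fun i => proj1_sig (constructive_indefinite_description _ (Ha i))).
  assert (Hb : forall i, (forall k, a i k <= b i k) /\
    (forall x, N i x -> exists k, a i k <= x <= b i k) /\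
    (forall K, rsum (fun k => b i k - a i k) K <= c i)).
  { intros i. exact (proj2_sig (constructive_indefinite_description _ (Ha i))). }
  apply (covered_double _ _ a b).
  - intros i j. apply Hb.
  - intros x [i Hx]. exists i. now apply Hb.
  - intros K. eapply Rle_trans; [|exact (HC K)]. apply rsum_le. intros i _. apply Hb.
Qed.

Lemma covered_or (N N' : R -> Prop) (c c' : R) :
  covered N c -> covered N' c' -> covered (fun x => N x \/ N' x) (c + c').
Proof.
  intros H H'.
  assert (P : 0 <= c) by (destruct H as [? [? [_ [_ H]]]]; exact (H O)).
  assert (P' : 0 <= c') by (destruct H' as [? [? [_ [_ H']]]]; exact (H' O)).
  set (Ns := fun i => match i with O => N | S O => N' | _ => fun _ => False end).
  set (cs := fun i => match i with O => c | S O => c' | _ => 0 end).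
  apply covered_sub with (fun x => exists i, Ns i x) (c + c'); [|lra|].
  - intros x [Hx|Hx]; [exists 0%nat|exists 1%nat]; exact Hx.
  - apply covered_union with cs.
    + intros [|[|i]]; simpl; try assumption.
      exists (fun _ => 0), (fun _ => 0). split; [intros; lra|]. split; [intros x []|].
      intros K. rewrite rsum_const. lra.
    + intros K. eapply Rle_trans; [apply (rsum_support cs 2)|].
      * intros [|[|i]]; simpl; lra.
      * intros [|[|i]] Hi; simpl; lia || lra.
      * simpl. lra.
Qed.

(** * Dyadic expansions *)

Lemma Int_part_half (u : R) : Int_part u = (Int_part (2 * u) / 2)%Z.
Proof.
  symmetry. apply Int_part_spec. destruct (base_Int_part (2 * u)) as [H1 H2].
  set (q := Int_part (2 * u)) in *. assert (E := Z.div_mod q 2 ltac:(lia)).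
  assert (B := Z.mod_pos_bound q 2 ltac:(lia)).
  assert (L1 : (2 * (q / 2) <= q)%Z) by lia. assert (L2 : (q <= 2 * (q / 2) + 1)%Z) by lia.
  apply IZR_le in L1, L2. rewrite plus_IZR in L2. rewrite mult_IZR in L1, L2. lra.
Qed.

Lemma Int_part_add (m : Z) (u : R) : Int_part (IZR m + u) = (m + Int_part u)%Z.
Proof.
  symmetry. apply Int_part_spec. destruct (base_Int_part u). rewrite plus_IZR. lra.
Qed.

Lemma Int_part_pow2_eq (x y : R) (M : nat) :
  Int_part (x * 2 ^ M) = Int_part (y * 2 ^ M) ->
  forall j, (j <= M)%nat -> Int_part (x * 2 ^ j) = Int_part (y * 2 ^ j).
Proof.
  induction M as [|M IH]; intros H j Hj.
  - now replace j with O by lia.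
  - destruct (Nat.eq_dec j (S M)) as [->|Hne]; [assumption|]. apply IH; [|lia].
    rewrite (Int_part_half (x * _)), (Int_part_half (y * _)).
    replace (2 * (x * 2 ^ M)) with (x * 2 ^ S M) by (simpl; ring).
    replace (2 * (y * 2 ^ M)) with (y * 2 ^ S M) by (simpl; ring). now rewrite H.
Qed.

Lemma xdigit_agree (x y : R) (M : nat) :
  Int_part (x * 2 ^ M) = Int_part (y * 2 ^ M) -> agree M (xdigit x) (xdigit y).
Proof.
  intros H k Hk. unfold xdigit. f_equal. now apply Int_part_pow2_eq with M.
Qed.

Definition bitR (b : bool) : R := if b then 1 else 0.

(** Left endpoint of the level-[M] cell of [z]. *)
Definition val (M : nat) (z : digits) : R := rsum (fun k => bitR (z k) * / 2 ^ S k) M.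

Lemma bitR_bounds (b : bool) : 0 <= bitR b <= 1.
Proof. destruct b; simpl; lra. Qed.

Lemma val_S (M : nat) (z : digits) : val (S M) z = (bitR (z O) + val M (stail z)) / 2.
Proof.
  unfold val. rewrite rsum_shift.
  rewrite (rsum_ext (fun i => bitR (z (S i)) * / 2 ^ S (S i))
             (fun k => / 2 * (bitR (stail z k) * / 2 ^ S k))).
  - rewrite rsum_scal. simpl. field.
  - intros i _. unfold stail. assert (P := pow2_pos i). simpl. field. lra.
Qed.

Lemma val_mono (M L : nat) (z : digits) : (M <= L)%nat ->
  val M z <= val L z /\ val L z + / 2 ^ L <= val M z + / 2 ^ M.
Proof.
  intros H. induction H as [|L H IH]; [lra|].
  unfold val in *. cbn [rsum]. assert (B := bitR_bounds (z L)).
  assert (P := pow2_pos L).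
  assert (Q : / 2 ^ L = 2 * / 2 ^ S L) by (simpl; field; lra).
  assert (0 < / 2 ^ S L) by (apply Rinv_0_lt_compat, pow2_pos). destruct IH; split; nra.
Qed.

Lemma val_range (M : nat) (z : digits) : 0 <= val M z /\ val M z + / 2 ^ M <= 1.
Proof.
  destruct (val_mono 0 M z) as [H1 H2]; [lia|]. change (val 0 z) with 0 in H1, H2. simpl in H2. lra.
Qed.

Lemma val_lt_1 (M : nat) (z : digits) : val M z < 1.
Proof.
  destruct (val_range M z). assert (0 < / 2 ^ M) by (apply Rinv_0_lt_compat, pow2_pos). lra.
Qed.

Lemma val_agree (M : nat) (z y : digits) : agree M z y -> val M z = val M y.
Proof. intros H. apply rsum_ext. intros i Hi. now rewrite H. Qed.

Lemma val_xdigit (M : nat) (x : R) : 0 <= x < 1 ->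
  val M (xdigit x) <= x < val M (xdigit x) + / 2 ^ M.
Proof.
  intros Hx. assert (P := pow2_pos M).
  assert (H : val M (xdigit x) * 2 ^ M = IZR (Int_part (x * 2 ^ M))).
  { clear P. induction M as [|M IH].
    - unfold val. simpl.
      replace (Int_part (x * 1)) with 0%Z by (apply Int_part_spec; simpl; lra). simpl. lra.
    - unfold val in *. cbn [rsum]. rewrite Rmult_plus_distr_r.
      assert (P := pow2_pos M).
      replace (bitR (xdigit x M) * / 2 ^ S M * 2 ^ S M) with (bitR (xdigit x M))
        by (simpl; field; lra).
      replace (2 ^ S M) with (2 ^ M * 2) at 1 by (simpl; ring).
      rewrite <- Rmult_assoc, IH. rewrite (Int_part_half (x * 2 ^ M)).
      replace (2 * (x * 2 ^ M)) with (x * 2 ^ S M) by (simpl; ring).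
      unfold xdigit. set (q := Int_part (x * 2 ^ S M)).
      assert (E := Z.div_mod q 2 ltac:(lia)). rewrite Zmod_odd in E.
      rewrite E at 3. rewrite plus_IZR, mult_IZR. destruct (Z.odd q); simpl; lra. }
  destruct (base_Int_part (x * 2 ^ M)) as [B1 B2]. rewrite <- H in B1, B2.
  split.
  - apply Rmult_le_reg_r with (2 ^ M); assumption.
  - apply Rmult_lt_reg_r with (2 ^ M); [assumption|].
    rewrite Rmult_plus_distr_r, Rinv_l by lra. lra.
Qed.

Lemma xdigit_val (M : nat) : forall z k, (k < M)%nat -> xdigit (val M z) k = z k.
Proof.
  induction M as [|M IH]; intros z k Hk; [lia|].
  rewrite val_S. unfold xdigit. set (m := if z O then 1%Z else 0%Z).
  assert (Em : bitR (z O) = IZR m) by (unfold m; destruct (z O); reflexivity).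
  rewrite Em. destruct k as [|k].
  - replace ((IZR m + val M (stail z)) / 2 * 2 ^ 1) with (IZR m + val M (stail z))
      by (simpl; field).
    rewrite Int_part_add. replace (Int_part (val M (stail z))) with 0%Z.
    + unfold m. destruct (z O); reflexivity.
    + apply Int_part_spec. destruct (val_range M (stail z)).
      assert (A := val_lt_1 M (stail z)). simpl. lra.
  (* The leading digit contributes an even integer, which leaves the parity of the floor
     unchanged. *)
  - replace ((IZR m + val M (stail z)) / 2 * 2 ^ S (S k))
      with (IZR (2 * (m * 2 ^ Z.of_nat k)) + val M (stail z) * 2 ^ S k).
    + rewrite Int_part_add, Z.odd_add, Z.odd_mul. simpl andb. rewrite Bool.xorb_false_l.
      fold (xdigit (val M (stail z)) k). now rewrite IH by lia.
    + rewrite !mult_IZR, <- pow_IZR. simpl. field.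
Qed.

Lemma val_dig (M j : nat) : (j < 2 ^ M)%nat -> val M (dig M j) = INR j * / 2 ^ M.
Proof.
  revert j. induction M as [|M IH]; intros j Hj.
  - simpl in Hj. replace j with O by lia. unfold val. simpl. lra.
  - assert (P := pow2_pos M). rewrite val_S. simpl dig.
    destruct (Nat.ltb_spec j (2 ^ M)).
    + change (stail (scons false (dig M j))) with (dig M j). rewrite IH by assumption.
      simpl. field. lra.
    + change (stail (scons true (dig M (j - 2 ^ M)))) with (dig M (j - 2 ^ M)).
      rewrite IH by (simpl in Hj; lia). rewrite minus_INR, INR_pow2 by assumption.
      simpl. field. lra.
Qed.

(** Continuity from below: each level lists only the cells that enter at that level, so the total
    lengths telescope to the measure of the last [E L]. *)
Lemma covered_dyadic (E : nat -> digits -> Prop) (c : R) :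
  (forall M z, E M z -> E (S M) z) ->
  (forall M x y, agree M x y -> E M x -> E M y) ->
  (forall M, mean M (fun z => chi (E M z)) <= c) ->
  covered (fun x => 0 <= x < 1 /\ exists M, E M (xdigit x)) c.
Proof.
  intros Hincr Hagree Hmean.
  set (new := fun M z => E M z /\ match M with O => True | S L => ~ E L z end).
  (* All other pairs of indices receive degenerate intervals, which keeps the double family
     total. *)
  set (len := fun M j => chi ((j < 2 ^ M)%nat /\ new M (dig M j)) * / 2 ^ M).
  assert (Hpos : forall M, 0 < / 2 ^ M) by (intros; apply Rinv_0_lt_compat, pow2_pos).
  assert (Hlen : forall M j, 0 <= len M j).
  { intros. apply Rmult_le_pos; [apply chi_bounds|apply Rlt_le, Hpos]. }
  apply (covered_double _ _ (fun M j => val M (dig M j))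
           (fun M j => val M (dig M j) + len M j)).
  - intros i j. specialize (Hlen i j). lra.
  - intros x [Hx [M0 HM0]].
    assert (Hleast : exists M, new M (xdigit x)).
    { revert HM0. induction M0 as [|L IH]; intros HL; [exists O; now split|].
      destruct (classic (E L (xdigit x))) as [H|H]; [now apply IH|]. exists (S L). now split. }
    destruct Hleast as [M [HM1 HM2]]. destruct (dig_surj M (xdigit x)) as [j [Hj Ej]].
    exists M, j. rewrite Ej, (val_agree M _ (xdigit x)) by now apply strunc_agree.
    unfold len. rewrite chi_true.
    + assert (A := val_xdigit M x Hx). lra.
    + split; [assumption|]. rewrite Ej. split.
      * apply Hagree with (xdigit x); [|assumption]. apply agree_sym. now apply strunc_agree.
      * destruct M as [|L]; [exact I|]. intros H. apply HM2.
        apply Hagree with (strunc (S L) (xdigit x)); [|assumption]. apply strunc_agree. lia.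
  - intros K.
    apply Rle_trans with (rsum (fun M => mean M (fun z => chi (new M z))) K).
    + apply rsum_le. intros M _.
      rewrite (rsum_ext _ (len M)) by (intros; lra).
      eapply Rle_trans; [apply (rsum_support _ (2 ^ M))|].
      * apply Hlen.
      * intros j Hj. unfold len. rewrite chi_false; [lra|]. intros [H _]. lia.
      * rewrite mean_dig, <- rsum_scal. apply rsum_le. intros j Hj. unfold len.
        rewrite Rmult_comm. apply Rmult_le_compat_l; [apply Rlt_le, Hpos|].
        apply chi_mono. tauto.
    + assert (H : forall L, rsum (fun M => mean M (fun z => chi (new M z))) (S L)
                       = mean L (fun z => chi (E L z))).
      { induction L as [|L IH].
        - cbn [rsum]. rewrite Rplus_0_l. apply mean_ext. intros z _.
          apply Rle_antisym; apply chi_mono; unfold new; tauto.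
        - cbn [rsum] in *. rewrite IH.
          rewrite <- (mean_depends_S L (fun z => chi (E L z))).
          + rewrite <- mean_plus. apply mean_ext. intros z _.
            destruct (classic (E L z)) as [H|H].
            * rewrite (chi_true (E L z)), (chi_true (E (S L) z)) by auto.
              rewrite chi_false by (unfold new; tauto). lra.
            * rewrite (chi_false (E L z)) by assumption. rewrite Rplus_0_l.
              apply Rle_antisym; apply chi_mono; unfold new; tauto.
          + intros y z Hyz. apply Rle_antisym; apply chi_mono; apply Hagree;
              [|apply agree_sym]; assumption. }
      destruct K as [|L].
      * simpl. eapply Rle_trans; [|exact (Hmean O)]. apply mean_nonneg. intros.
        apply chi_bounds.
      * rewrite H. apply Hmean.
Qed.

(** * McShane integrals along uniform dyadic partitions *)

(** Heine-Borel by a supremum: the gauge at the supremum [b] reaches beyond it. Free tags are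
    essential, since a uniform fine partition need not exist when tags are confined to their
    cells. *)
Lemma lebesgue_number (delta : R -> R) : (forall x, 0 < delta x) ->
  exists r, 0 < r /\ forall u v, 0 <= u <= v -> v <= 1 -> v - u <= r ->
    exists t, 0 <= t <= 1 /\ t - delta t < u /\ v < t + delta t.
Proof.
  intros Hd.
  set (ok := fun x => 0 <= x <= 1 /\ exists r, 0 < r /\ forall u v, 0 <= u <= v -> v <= x ->
    v - u <= r -> exists t, 0 <= t <= 1 /\ t - delta t < u /\ v < t + delta t).
  assert (Hok0 : ok 0).
  { split; [lra|]. exists 1. split; [lra|]. intros u v H1 H2 _. exists 0.
    assert (A := Hd 0). repeat split; lra. }
  destruct (completeness ok) as [b [Hb1 Hb2]].
  { exists 1. intros x [Hx _]. lra. }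
  { now exists 0. }
  assert (Hb0 : 0 <= b) by now apply Hb1.
  assert (Hb1' : b <= 1) by (apply Hb2; intros x [Hx _]; lra).
  assert (Hdb := Hd b).
  assert (Hx : exists x, ok x /\ b - delta b / 2 < x).
  { apply NNPP. intros Hno. assert (A : b <= b - delta b / 2); [|lra].
    apply Hb2. intros x Hx. apply Rnot_lt_le. intros Hlt. apply Hno. now exists x. }
  destruct Hx as [x [[Hx01 [r [Hr Hcov]]] Hxb]].
  assert (Hnext : forall y, 0 <= y <= 1 -> y <= b + delta b / 2 -> ok y).
  { intros y Hy Hyb. split; [assumption|]. exists (Rmin r (delta b / 2)).
    split; [apply Rmin_glb_lt; lra|]. intros u v Huv Hv Hlen.
    assert (L1 := Rmin_l r (delta b / 2)). assert (L2 := Rmin_r r (delta b / 2)).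
    destruct (Rle_lt_dec v x) as [Hvx|Hvx].
    - apply Hcov; lra.
    - exists b. repeat split; lra. }
  assert (Hmin : ok (Rmin 1 (b + delta b / 2))).
  { apply Hnext; [|apply Rmin_r]. split; [|apply Rmin_l].
    apply Rmin_glb; lra. }
  assert (A := Hb1 _ Hmin).
  assert (H1 : Rmin 1 (b + delta b / 2) = 1).
  { unfold Rmin in *. destruct Rle_dec; lra. }
  rewrite H1 in Hmin. destruct Hmin as [_ [r' [Hr' Hc']]]. now exists r'.
Qed.

Lemma pow2_inv_small (e : R) (M0 : nat) : 0 < e -> exists M, (M0 <= M)%nat /\ / 2 ^ M < e.
Proof.
  intros He. destruct (pow_lt_1_zero (/ 2)) with (y := e) as [K HK].
  - rewrite Rabs_right; lra.
  - assumption.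
  - exists (Nat.max K M0). split; [lia|]. specialize (HK (Nat.max K M0) ltac:(lia)).
    rewrite pow_inv in HK. rewrite Rabs_right in HK; [assumption|].
    apply Rle_ge, Rlt_le, Rinv_0_lt_compat, pow2_pos.
Qed.

Definition cell_fine (delta : R -> R) (M : nat) (z : digits) (t : R) : Prop :=
  0 <= t <= 1 /\ t - delta t < val M z /\ val M z + / 2 ^ M < t + delta t.

Lemma cell_fine_agree (delta : R -> R) (M : nat) (z y : digits) (t : R) :
  agree M z y -> cell_fine delta M z t -> cell_fine delta M y t.
Proof. intros H. unfold cell_fine. now rewrite (val_agree M z y H). Qed.

Lemma cell_fine_gauge (delta delta' : R -> R) (M : nat) (z : digits) (t : R) :
  (forall x, delta x <= delta' x) -> cell_fine delta M z t -> cell_fine delta' M z t.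
Proof. intros H [H1 [H2 H3]]. specialize (H t). repeat split; lra. Qed.

Lemma cell_fine_refine (delta : R -> R) (M L : nat) (z : digits) (t : R) :
  (M <= L)%nat -> cell_fine delta M z t -> cell_fine delta L z t.
Proof.
  intros H [H1 [H2 H3]]. destruct (val_mono M L z H). repeat split; lra.
Qed.

Lemma fine_tags_exist (delta : R -> R) (M0 : nat) : (forall x, 0 < delta x) ->
  exists M, (M0 <= M)%nat /\ exists tag : digits -> R, forall z, cell_fine delta M z (tag z).
Proof.
  intros Hd. destruct (lebesgue_number delta Hd) as [r [Hr Hcov]].
  destruct (pow2_inv_small r M0 Hr) as [M [HM HrM]]. exists M. split; [assumption|].
  assert (H : forall z, exists t, cell_fine delta M z t).
  { intros z. destruct (val_range M z) as [V1 V2].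
    assert (0 < / 2 ^ M) by (apply Rinv_0_lt_compat, pow2_pos).
    destruct (Hcov (val M z) (val M z + / 2 ^ M)) as [t Ht]; try lra. now exists t. }
  exists (fun z => proj1_sig (constructive_indefinite_description _ (H z))).
  intros z. exact (proj2_sig (constructive_indefinite_description _ (H z))).
Qed.

Definition fine_tagging (delta : R -> R) (M : nat) (tag : digits -> R) : Prop :=
  forall z, supp M z -> cell_fine delta M z (tag z).

Lemma fine_tagging_gauge (delta delta' : R -> R) (M : nat) (tag : digits -> R) :
  (forall x, delta x <= delta' x) -> fine_tagging delta M tag -> fine_tagging delta' M tag.
Proof. intros H Ht z Hz. apply cell_fine_gauge with delta; auto. Qed.

Lemma integral_mean (f : R -> R) (I eps : R) : is_integral01 f I -> 0 < eps ->
  exists delta : R -> R, (forall x, 0 < delta x) /\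
    forall M tag, fine_tagging delta M tag ->
      Rabs (mean M (fun z => f (tag z)) - I) < eps.
Proof.
  intros HI Heps. destruct (HI eps Heps) as [delta [Hd H]]. exists delta.
  split; [assumption|]. intros M tag Htag. assert (P := pow2_pos M).
  specialize (H (2 ^ M)%nat (fun i => INR i * / 2 ^ M) (fun i => tag (dig M i))).
  replace (mean M (fun z => f (tag z))) with
    (riemann_sum f (2 ^ M) (fun i => INR i * / 2 ^ M) (fun i => tag (dig M i))).
  - apply H. repeat split.
    + simpl. lra.
    + rewrite INR_pow2. field. lra.
    + rewrite S_INR. assert (0 < / 2 ^ M) by now apply Rinv_0_lt_compat. lra.
    + apply (Htag (dig M i)), supp_dig.
    + apply (Htag (dig M i)), supp_dig.
    + rewrite <- val_dig by assumption. apply (Htag (dig M i)), supp_dig.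
    + rewrite S_INR, Rmult_plus_distr_r, <- val_dig, Rmult_1_l by assumption.
      apply (Htag (dig M i)), supp_dig.
  - rewrite mean_dig. unfold riemann_sum. rewrite <- rsum_scal. apply rsum_ext.
    intros i _. rewrite S_INR. ring.
Qed.

Lemma mean_point_tag (delta : R -> R) (M : nat) (tag : digits -> R) (d : R) :
  0 < delta d -> fine_tagging delta M tag ->
  mean M (fun z => chi (tag z = d)) <= 2 * delta d.
Proof.
  intros Hd Htag.
  (* A cell tagged [d] lies where [clamp] is the identity, so its length is an increment of [clamp];
     all increments together telescope to at most [2 * delta d]. *)
  set (clamp := fun y => Rmin (Rmax y (d - delta d)) (d + delta d)).
  assert (Hmono : forall x y, x <= y -> clamp x <= clamp y).
  { intros x y Hxy. unfold clamp, Rmin, Rmax. repeat destruct Rle_dec; lra. }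
  rewrite mean_dig, <- rsum_scal. assert (P := pow2_pos M).
  assert (Q : 0 < / 2 ^ M) by now apply Rinv_0_lt_compat.
  apply Rle_trans with (rsum (fun j => clamp (INR (S j) * / 2 ^ M) - clamp (INR j * / 2 ^ M))
                          (2 ^ M)).
  - apply rsum_le. intros j Hj. rewrite S_INR.
    destruct (classic (tag (dig M j) = d)) as [E|E].
    + rewrite chi_true by assumption.
      destruct (Htag (dig M j) (supp_dig M j)) as [_ [F1 F2]]. rewrite E in F1, F2.
      rewrite val_dig in F1, F2 by assumption.
      unfold clamp, Rmin, Rmax. repeat destruct Rle_dec; lra.
    + rewrite chi_false by assumption.
      assert (A := Hmono (INR j * / 2 ^ M) ((INR j + 1) * / 2 ^ M)). lra.
  - assert (T : forall K, rsum (fun j => clamp (INR (S j) * / 2 ^ M) - clamp (INR j * / 2 ^ M)) K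
                = clamp (INR K * / 2 ^ M) - clamp (INR 0 * / 2 ^ M)).
    { induction K as [|K IH]; cbn [rsum]; [lra|]. rewrite IH. lra. }
    rewrite T. unfold clamp, Rmin, Rmax. repeat destruct Rle_dec; lra.
Qed.

Lemma mean_finite_tags (f : R -> R) (p : nat -> R) (K : nat) (eta : R) : 0 < eta ->
  exists delta : R -> R, (forall x, 0 < delta x) /\
    forall M tag, fine_tagging delta M tag ->
      mean M (fun z => Rabs (f (tag z)) * chi (exists i, (i < K)%nat /\ tag z = p i)) <= eta.
Proof.
  intros Heta. set (n := INR (S K)). assert (Hn : 0 < n) by (apply lt_0_INR; lia).
  assert (Hf : forall x, 0 < Rabs (f x) + 1).
  { intros x. assert (A := Rabs_pos (f x)). lra. }
  (* Cells tagged [p i] have total length at most twice this, so each point contributes at most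
     [eta / n]. *)
  exists (fun x => eta * / (2 * n * (Rabs (f x) + 1))).
  assert (Hd : forall x, 0 < eta * / (2 * n * (Rabs (f x) + 1))).
  { intros x. apply Rmult_lt_0_compat; [assumption|]. apply Rinv_0_lt_compat.
    specialize (Hf x). nra. }
  split; [assumption|]. intros M tag Htag.
  apply Rle_trans with (mean M (fun z => rsum (fun i => Rabs (f (p i)) * chi (tag z = p i)) K)).
  - apply mean_le. intros z _.
    assert (Pos : forall i, 0 <= Rabs (f (p i)) * chi (tag z = p i)).
    { intros. apply Rmult_le_pos; [apply Rabs_pos|apply chi_bounds]. }
    destruct (classic (exists i, (i < K)%nat /\ tag z = p i)) as [H|H].
    + rewrite (chi_true (exists i, _)) by assumption. destruct H as [i [Hi Ei]].
      apply Rle_trans with (Rabs (f (p i)) * chi (tag z = p i)).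
      * rewrite chi_true, Ei by assumption. lra.
      * apply (rsum_single (fun i => Rabs (f (p i)) * chi (tag z = p i))); auto.
    + rewrite (chi_false (exists i, _)) by assumption. rewrite Rmult_0_r.
      now apply rsum_nonneg.
  - rewrite (mean_rsum M K).
    apply Rle_trans with (rsum (fun _ => eta / n) K).
    + apply rsum_le. intros i _. rewrite mean_scal.
      assert (A := mean_point_tag _ M tag (p i) (Hd (p i)) Htag). cbv beta in A.
      assert (B := Rabs_pos (f (p i))).
      eapply Rle_trans; [apply Rmult_le_compat_l; [exact B|exact A]|].
      specialize (Hf (p i)).
      replace (Rabs (f (p i)) * (2 * (eta * / (2 * n * (Rabs (f (p i)) + 1)))))
        with (eta / n * (Rabs (f (p i)) * / (Rabs (f (p i)) + 1))) by (field; lra).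
      rewrite <- (Rmult_1_r (eta / n)) at 2. apply Rmult_le_compat_l.
      * apply Rlt_le. apply Rdiv_lt_0_compat; assumption.
      * apply Rmult_le_reg_r with (Rabs (f (p i)) + 1); [assumption|].
        rewrite Rmult_assoc, Rinv_l by lra. lra.
    + rewrite rsum_const. unfold n. rewrite S_INR.
      assert (HK := pos_INR K). apply Rmult_le_reg_r with (INR K + 1); [lra|].
      replace (INR K * (eta / (INR K + 1)) * (INR K + 1)) with (INR K * eta) by (field; lra).
      nra.
Qed.

Definition on_grid (M : nat) (x : R) : Prop :=
  exists i, (i < S (2 ^ M))%nat /\ x = INR i * / 2 ^ M.

Lemma on_grid_of_int (M : nat) (x : R) :
  0 <= x <= 1 -> IZR (Int_part (x * 2 ^ M)) = x * 2 ^ M -> on_grid M x.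
Proof.
  intros Hx H. assert (P := pow2_pos M). set (q := Int_part (x * 2 ^ M)) in *.
  assert (Hq0 : (0 <= q)%Z) by (apply le_IZR; rewrite H; nra).
  assert (Hq1 : (q <= Z.of_nat (2 ^ M))%Z).
  { apply le_IZR. rewrite H, <- INR_IZR_INZ, INR_pow2. nra. }
  exists (Z.to_nat q). split; [lia|].
  rewrite INR_IZR_INZ, Z2Nat.id, H by assumption. field. lra.
Qed.

(** Off the grid the gauge is the distance to the grid, which forces a fine cell into the level-[M]
    cell of its tag. A grid point may tag cells on both sides, whose digits differ, hence the
    exclusion and the arbitrary value 1 there. *)
Lemma grid_gauge (M : nat) : exists delta : R -> R, (forall x, 0 < delta x) /\
  forall L z t, (M <= L)%nat -> cell_fine delta L z t -> ~ on_grid M t -> agree M z (xdigit t).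
Proof.
  assert (P := pow2_pos M). assert (Q : 0 < / 2 ^ M) by now apply Rinv_0_lt_compat.
  set (q := fun x => IZR (Int_part (x * 2 ^ M))).
  assert (Hq : forall x, q x <= x * 2 ^ M < q x + 1).
  { intros x. unfold q. destruct (base_Int_part (x * 2 ^ M)). lra. }
  exists (fun x => if Req_dec_T (q x) (x * 2 ^ M) then 1
             else / 2 ^ M * Rmin (x * 2 ^ M - q x) (q x + 1 - x * 2 ^ M)).
  split.
  - intros x. specialize (Hq x). destruct Req_dec_T as [E|E]; [lra|].
    apply Rmult_lt_0_compat; [assumption|]. apply Rmin_glb_lt; lra.
  - intros L z t HML [Ht [F1 F2]] Hgrid. specialize (Hq t).
    destruct Req_dec_T as [E|E]; [elim Hgrid; now apply on_grid_of_int|].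
    set (m := Rmin (t * 2 ^ M - q t) (q t + 1 - t * 2 ^ M)) in *.
    assert (M1 : m <= t * 2 ^ M - q t) by apply Rmin_l.
    assert (M2 : m <= q t + 1 - t * 2 ^ M) by apply Rmin_r.
    assert (HL : 0 < / 2 ^ L) by (apply Rinv_0_lt_compat, pow2_pos).
    assert (G1 : t * 2 ^ M - m < val L z * 2 ^ M).
    { replace (t * 2 ^ M - m) with ((t - / 2 ^ M * m) * 2 ^ M) by (field; lra).
      apply Rmult_lt_compat_r; assumption. }
    assert (G2 : val L z * 2 ^ M < t * 2 ^ M + m).
    { replace (t * 2 ^ M + m) with ((t + / 2 ^ M * m) * 2 ^ M) by (field; lra).
      apply Rmult_lt_compat_r; lra. }
    assert (A : agree M (xdigit (val L z)) (xdigit t)).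
    { apply xdigit_agree. symmetry. apply Int_part_spec. fold (q t). lra. }
    intros k Hk. rewrite <- A by assumption. symmetry. apply xdigit_val. lia.
Qed.

Lemma integral_family (F : nat -> R -> R) (c : nat -> R) (K : nat) (eta : R) :
  (forall i, is_integral01 (F i) (c i)) -> 0 < eta ->
  exists delta : R -> R, (forall x, 0 < delta x) /\
    forall M tag, fine_tagging delta M tag ->
      forall i, (i < K)%nat -> Rabs (mean M (fun z => F i (tag z)) - c i) < eta.
Proof.
  intros HF Heta. induction K as [|K [d1 [Hd1 H1]]].
  - exists (fun _ => 1). split; [intros; lra|]. intros; lia.
  - destruct (integral_mean (F K) (c K) eta (HF K) Heta) as [d2 [Hd2 H2]].
    exists (fun x => Rmin (d1 x) (d2 x)). split; [intros; now apply Rmin_glb_lt|].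
    intros M tag Htag i Hi. destruct (Nat.eq_dec i K) as [->|Hne].
    + apply H2. eapply fine_tagging_gauge; [|exact Htag]. intros; apply Rmin_r.
    + apply H1; [|lia]. eapply fine_tagging_gauge; [|exact Htag]. intros; apply Rmin_l.
Qed.

(** The Walsh function is evaluated on the cell instead of at the tag, so that the average is the
    exact coefficient of a function of digits and convolution formulas apply. *)
Lemma coefficient_mean (f : R -> R) (c : nat -> R) (M : nat) (eta : R) :
  (forall i, is_integral01 (fun t => f t * walsh i t) (c i)) -> 0 < eta ->
  exists delta : R -> R, (forall x, 0 < delta x) /\
    forall L tag, (M <= L)%nat -> fine_tagging delta L tag ->
      forall i, (i < 2 ^ M)%nat ->
        Rabs (mean L (fun z => f (tag z) * wal i z) - c i) < eta.
Proof.
  intros Hc Heta.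
  destruct (integral_family (fun i t => f t * walsh i t) c (2 ^ M) (eta / 2) Hc ltac:(lra))
    as [d1 [Hd1 H1]].
  (* At grid tags the two Walsh values differ by at most 2, so [eta / 4] costs [eta / 2]. *)
  destruct (mean_finite_tags f (fun i => INR i * / 2 ^ M) (S (2 ^ M)) (eta / 4) ltac:(lra))
    as [d2 [Hd2 H2]].
  destruct (grid_gauge M) as [d3 [Hd3 H3]].
  exists (fun x => Rmin (d1 x) (Rmin (d2 x) (d3 x))).
  split; [intros; repeat apply Rmin_glb_lt; auto|].
  intros L tag HL Htag i Hi.
  assert (T1 : fine_tagging d1 L tag).
  { eapply fine_tagging_gauge; [|exact Htag]. intros; apply Rmin_l. }
  assert (T2 : fine_tagging d2 L tag).
  { eapply fine_tagging_gauge; [|exact Htag]. intros x.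
    eapply Rle_trans; [apply Rmin_r|apply Rmin_l]. }
  assert (T3 : fine_tagging d3 L tag).
  { eapply fine_tagging_gauge; [|exact Htag]. intros x.
    eapply Rle_trans; [apply Rmin_r|apply Rmin_r]. }
  specialize (H1 L tag T1 i Hi). specialize (H2 L tag T2). cbv beta in H1, H2.
  replace (mean L (fun z => f (tag z) * wal i z) - c i) with
    (mean L (fun z => f (tag z) * wal i z - f (tag z) * walsh i (tag z))
     + (mean L (fun z => f (tag z) * walsh i (tag z)) - c i)) by (rewrite mean_minus; ring).
  eapply Rle_lt_trans; [apply Rabs_triang|].
  assert (B : Rabs (mean L (fun z => f (tag z) * wal i z - f (tag z) * walsh i (tag z)))
     <= 2 * (eta / 4)).
  { eapply Rle_trans; [apply mean_abs|].
    eapply Rle_trans; [|apply Rmult_le_compat_l; [lra|exact H2]].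
    rewrite <- mean_scal. apply mean_le. intros z Hz.
    rewrite walsh_wal, <- Rmult_minus_distr_l, Rabs_mult.
    assert (A := Rabs_pos (f (tag z))).
    destruct (classic (on_grid M (tag z))) as [Hg|Hg].
    - rewrite chi_true by exact Hg.
      assert (C := Rabs_triang (wal i z) (- wal i (xdigit (tag z)))).
      rewrite Rabs_Ropp, !wal_abs in C. unfold Rminus. nra.
    - rewrite chi_false by exact Hg.
      rewrite (wal_depends i M Hi z (xdigit (tag z)) (H3 L z (tag z) HL (T3 z Hz) Hg)).
      rewrite Rminus_diag, Rabs_R0. lra. }
  lra.
Qed.

(** * Approximation by step functions in $L_1$ and in measure *)

Section StepApproximation.
Context (f : R -> R) (I eps : R) (delta : R -> R) (N : nat) (t : digits -> R).
Context (Hdelta : forall x, 0 < delta x).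
Context (Hgauge : forall M tag, fine_tagging delta M tag ->
                    Rabs (mean M (fun z => f (tag z)) - I) < eps).
Context (Ht : forall z, cell_fine delta N z (t z)).

Definition step (z : digits) : R := f (t (strunc N z)).

Lemma step_depends : depends N step.
Proof. intros x y H. unfold step. now rewrite (strunc_depends N x y H). Qed.

(* In the McShane integral tags are free, so any cell may exchange its tag with the tag of
   the step function; one-sided exchanges change the Riemann sum by less than [2 * eps]. *)
Lemma step_exchange (M : nat) (s : digits -> R) (P : digits -> Prop) : (N <= M)%nat ->
  (forall z, supp M z -> P z -> cell_fine delta M z (s z)) ->
  mean M (fun z => chi (P z) * Rabs (f (s z) - step z)) <= 4 * eps.
Proof.
  intros HNM Hs.
  assert (Hstep : fine_tagging delta M (fun z => t (strunc N z))).
  { intros z _. apply cell_fine_refine with N; [assumption|].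
    apply cell_fine_agree with (strunc N z); [now apply strunc_agree|]. apply Ht. }
  assert (Hone : forall P' : digits -> Prop, (forall z, P' z -> P z) ->
    Rabs (mean M (fun z => chi (P' z) * (f (s z) - step z))) <= 2 * eps).
  { intros P' HP'.
    set (tag := fun z => if excluded_middle_informative (P' z) then s z else t (strunc N z)).
    assert (Htag : fine_tagging delta M tag).
    { intros z Hz. unfold tag. destruct excluded_middle_informative; auto. }
    assert (G1 := Hgauge M tag Htag). assert (G2 := Hgauge M _ Hstep). cbv beta in G2.
    replace (mean M (fun z => chi (P' z) * (f (s z) - step z))) with
      ((mean M (fun z => f (tag z)) - I) - (mean M (fun z => f (t (strunc N z))) - I)).
    - eapply Rle_trans; [apply Rabs_triang|]. rewrite Rabs_Ropp. lra.
    - replace (mean M (fun z => f (tag z)) - I - (mean M (fun z => f (t (strunc N z))) - I))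
        with (mean M (fun z => f (tag z)) - mean M (fun z => f (t (strunc N z)))) by ring.
      rewrite <- mean_minus. apply mean_ext. intros z _. unfold tag, chi, step.
      destruct excluded_middle_informative; ring. }
  assert (A := Hone (fun z => P z /\ step z <= f (s z)) (fun z H => proj1 H)).
  assert (B := Hone (fun z => P z /\ f (s z) < step z) (fun z H => proj1 H)).
  assert (Hb : forall x a, Rabs x <= a -> - a <= x <= a)
    by (intros x a; unfold Rabs; destruct Rcase_abs; lra).
  apply Hb in A, B.
  rewrite (mean_ext M _ (fun z => chi (P z /\ step z <= f (s z)) * (f (s z) - step z)
       - chi (P z /\ f (s z) < step z) * (f (s z) - step z))).
  - rewrite mean_minus. lra.
  - intros z _. unfold chi, Rabs.
    destruct Rcase_abs; repeat destruct excluded_middle_informative;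
      first [lra | exfalso; intuition lra].
Qed.

(** A point [x] of large deviation is itself an admissible tag of its small dyadic cells, so some
    [E M] catches it. Choosing a deviating tag in every cell of [E M] and exchanging gives the
    measure by Chebyshev's inequality. *)
Lemma step_approx_covered (lam : R) : 0 < lam ->
  covered (fun x => 0 <= x < 1 /\ lam < Rabs (f x - step (xdigit x))) (4 * eps / lam).
Proof.
  intros Hlam.
  set (E := fun M z => (N <= M)%nat /\
              exists s, cell_fine delta M z s /\ lam < Rabs (f s - step z)).
  apply covered_sub with (fun x => 0 <= x < 1 /\ exists M, E M (xdigit x)) (4 * eps / lam);
    [|lra|].
  - intros x [Hx Hfx]. split; [assumption|].
    destruct (pow2_inv_small (delta x) N (Hdelta x)) as [M [HM HMd]].
    exists M. split; [assumption|]. exists x. split; [|assumption].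
    destruct (val_xdigit M x Hx). repeat split; lra.
  - apply covered_dyadic.
    + intros M z [HM [s [Hs1 Hs2]]]. split; [lia|]. exists s. split; [|assumption].
      apply cell_fine_refine with M; [lia|assumption].
    + intros M x y Hxy [HM [s [Hs1 Hs2]]]. split; [assumption|]. exists s. split.
      * now apply cell_fine_agree with x.
      * rewrite <- (step_depends x y); [assumption|]. intros k Hk. apply Hxy. lia.
    + intros M. destruct (Nat.le_gt_cases N M) as [HNM|HNM].
      * assert (Hs : forall z, exists s, E M z ->
                  cell_fine delta M z s /\ lam < Rabs (f s - step z)).
        { intros z. destruct (classic (E M z)) as [[H1 [s H2]]|H].
          - exists s. auto.
          - exists 0. tauto. }
        set (s := fun z => proj1_sig (constructive_indefinite_description _ (Hs z))).
        assert (Hs' : forall z, E M z -> cell_fine delta M z (s z) /\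
                                   lam < Rabs (f (s z) - step z))
          by (intros z; exact (proj2_sig (constructive_indefinite_description _ (Hs z)))).
        assert (A := step_exchange M s (E M) HNM (fun z _ H => proj1 (Hs' z H))).
        apply Rmult_le_reg_l with lam; [assumption|].
        replace (lam * (4 * eps / lam)) with (4 * eps) by (field; lra).
        eapply Rle_trans; [|exact A]. rewrite <- mean_scal. apply mean_le. intros z _.
        destruct (classic (E M z)) as [H|H].
        -- destruct (Hs' z H). rewrite chi_true by assumption. lra.
        -- rewrite chi_false by assumption. lra.
      * rewrite (mean_ext M _ (fun _ => 0)).
        -- rewrite mean_const.
           (* Nonnegativity of [eps] is read off from the exchange inequality. *)
           assert (A := step_exchange N t (fun _ => True) (le_n N) (fun z _ _ => Ht z)).
           assert (B : 0 <= 4 * eps).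
           { eapply Rle_trans; [|exact A]. apply mean_nonneg. intros.
             apply Rmult_le_pos; [apply chi_bounds|apply Rabs_pos]. }
           apply Rle_mult_inv_pos; assumption.
        -- intros z _. apply chi_false. intros [H _]. lia.
Qed.
End StepApproximation.

(** * Logarithmic means on digit sequences *)

Definition spart (c : nat -> R) (n : nat) (z : digits) : R := rsum (fun i => c i * wal i z) n.

Definition lmean (c : nat -> R) (n : nat) (z : digits) : R :=
  / lsum n * rsum (fun i => spart c (n - 1 - i) z * / INR (S i)) (n - 1).

Lemma Lmean_lmean (c : nat -> R) (n : nat) (x : R) : Lmean c n x = lmean c n (xdigit x).
Proof.
  unfold Lmean, lmean, rsum_range. f_equal.
  replace (S (n - 1) - 1)%nat with (n - 1)%nat by lia. rewrite rsum_rev.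
  apply rsum_ext. intros i Hi. unfold Rdiv. f_equal.
  - replace (1 + (n - 1 - 1 - i))%nat with (n - 1 - i)%nat by lia.
    apply rsum_ext. intros j _. now rewrite walsh_wal.
  - do 2 f_equal. lia.
Qed.

Lemma spart_depends (c : nat -> R) (n M : nat) : (n <= 2 ^ M)%nat -> depends M (spart c n).
Proof.
  intros Hn x y H. apply rsum_ext. intros i Hi. f_equal.
  apply (wal_depends i M); [lia|assumption].
Qed.

Lemma lmean_depends (c : nat -> R) (n M : nat) : (n <= 2 ^ M)%nat -> depends M (lmean c n).
Proof.
  intros Hn x y H. unfold lmean. f_equal. apply rsum_ext. intros i Hi. f_equal.
  apply (spart_depends c _ M); [lia|assumption].
Qed.

Lemma lmean_plus (c d : nat -> R) (n : nat) (z : digits) :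
  lmean (fun i => c i + d i) n z = lmean c n z + lmean d n z.
Proof.
  unfold lmean. rewrite <- Rmult_plus_distr_l, <- rsum_plus. f_equal. apply rsum_ext.
  intros i _. unfold spart. rewrite <- Rmult_plus_distr_r, <- rsum_plus. f_equal.
  apply rsum_ext. intros; ring.
Qed.

Lemma lmean_ext (c d : nat -> R) (n : nat) (z : digits) :
  (forall i, (i < n)%nat -> c i = d i) -> lmean c n z = lmean d n z.
Proof.
  intros H. unfold lmean, spart. f_equal. apply rsum_ext. intros i Hi. f_equal.
  apply rsum_ext. intros j Hj. now rewrite H by lia.
Qed.

Lemma lsum_pos (n : nat) : (2 <= n)%nat -> 0 < lsum n.
Proof.
  intros Hn. assert (A := lsum_log n ltac:(lia)).
  assert (B : (1 <= Nat.log2 n)%nat) by (apply Nat.log2_le_pow2; simpl; lia).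
  apply (le_INR 1) in B. simpl in B. lra.
Qed.

(** A crude bound suffices, because [eta] will be chosen after a bound on [n]. *)
Lemma lmean_small (d : nat -> R) (n : nat) (z : digits) (eta : R) : (2 <= n)%nat ->
  (forall i, (i < n)%nat -> Rabs (d i) <= eta) -> Rabs (lmean d n z) <= eta * INR n.
Proof.
  intros Hn Hd. assert (Hl := lsum_pos n Hn).
  assert (He : 0 <= eta) by (eapply Rle_trans; [apply Rabs_pos|apply (Hd O); lia]).
  unfold lmean. rewrite Rabs_mult, Rabs_inv, (Rabs_right (lsum n)) by lra.
  apply Rmult_le_reg_l with (lsum n); [assumption|].
  rewrite <- Rmult_assoc, Rinv_r, Rmult_1_l by lra.
  eapply Rle_trans; [apply rsum_abs|].
  rewrite (lsum_harm n), Rmult_comm. unfold harm. rewrite <- rsum_scal.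
  apply rsum_le. intros i Hi. assert (P := inv_INR_nonneg i).
  rewrite Rabs_mult, (Rabs_right (/ INR (S i))) by lra.
  apply Rmult_le_compat_r; [assumption|].
  eapply Rle_trans; [apply rsum_abs|].
  apply Rle_trans with (rsum (fun _ => eta) (n - 1 - i)).
  - apply rsum_le. intros j Hj. rewrite Rabs_mult, wal_abs, Rmult_1_r. apply Hd. lia.
  - rewrite rsum_const, Rmult_comm. apply Rmult_le_compat_l; [assumption|].
    apply le_INR. lia.
Qed.

Lemma spart_mean (psi : digits -> R) (L n : nat) (z : digits) :
  spart (fun i => mean L (fun y => psi y * wal i y)) n z
  = mean L (fun y => psi y * dirichlet n (sxor z y)).
Proof.
  unfold spart, dirichlet.
  rewrite (mean_ext L _ (fun y => rsum (fun i => wal i z * (psi y * wal i y)) n)).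
  - rewrite (mean_rsum L n). apply rsum_ext. intros i _. rewrite mean_scal. ring.
  - intros y _. rewrite <- rsum_scal. apply rsum_ext. intros i _. rewrite wal_sxor. ring.
Qed.

Lemma lmean_mean (psi : digits -> R) (L n : nat) (z : digits) :
  lmean (fun i => mean L (fun y => psi y * wal i y)) n z
  = / lsum n * mean L (fun y => psi y * nkernel n (sxor z y)).
Proof.
  unfold lmean, nkernel. f_equal.
  rewrite (mean_ext L _ (fun y => rsum (fun i =>
     / INR (S i) * (psi y * dirichlet (n - 1 - i) (sxor z y))) (n - 1))).
  - rewrite (mean_rsum L (n - 1)). apply rsum_ext. intros i _.
    rewrite mean_scal, spart_mean. ring.
  - intros y _. rewrite <- rsum_scal. apply rsum_ext. intros; ring.
Qed.

(** * Logarithmic means of step functions *)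

Section StepFunction.
Context (g : digits -> R) (N : nat) (Hg : depends N g).

(** [N + i] digits determine both [g] and [wal i], as $i<2^i$. *)
Definition step_coef (i : nat) : R := mean (N + i) (fun z => g z * wal i z).

Lemma step_coef_mean (L i : nat) : (N <= L)%nat -> (i < 2 ^ L)%nat ->
  step_coef i = mean L (fun z => g z * wal i z).
Proof.
  intros HL Hi. set (u := fun z => g z * wal i z).
  assert (Hu : forall K, (N <= K)%nat -> (i < 2 ^ K)%nat -> depends K u).
  { intros K HK HiK x y H. unfold u. rewrite (wal_depends i K HiK x y H).
    rewrite (Hg x y); [reflexivity|]. intros k Hk. apply H. lia. }
  assert (HNi : (i < 2 ^ (N + i))%nat).
  { apply Nat.lt_le_trans with (2 ^ i)%nat; [apply Nat.pow_gt_lin_r; lia|].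
    apply Nat.pow_le_mono_r; lia. }
  unfold step_coef. fold u.
  rewrite <- (mean_depends (Nat.max L (N + i)) (N + i) u) by (try apply Hu; lia).
  apply mean_depends; [now apply Hu|lia].
Qed.

(** Flipping the digit $|i|\ge N$ negates [wal i] and leaves [g] unchanged. *)
Lemma step_coef_high (i : nat) : (2 ^ N <= i)%nat -> step_coef i = 0.
Proof.
  intros Hi. assert (P := pow2_nat_pos N). set (k := Nat.log2 i).
  assert (Hk := Nat.log2_spec i ltac:(lia)). fold k in Hk.
  assert (HNk : (N <= k)%nat) by (apply Nat.log2_le_pow2; lia).
  assert (Hki : (k < i)%nat).
  { apply Nat.log2_lt_pow2; [lia|]. apply Nat.pow_gt_lin_r. lia. }
  assert (E : forall z, wal i (flip k z) = - wal i z).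
  { intros z. set (j := (i - 2 ^ k)%nat).
    replace i with (2 ^ k + j)%nat by (unfold j; lia).
    assert (Hj : (j < 2 ^ k)%nat) by (unfold j; simpl in Hk; lia).
    rewrite !wal_pow2_add by assumption.
    rewrite (wal_depends j k Hj (flip k z) z) by (now apply agree_flip).
    unfold rad, flip. rewrite Nat.eqb_refl. destruct (z k); simpl; ring. }
  assert (A := mean_flip (N + i) k (fun z => g z * wal i z) ltac:(lia)). cbv beta in A.
  rewrite (mean_ext (N + i) (fun z => g (flip k z) * wal i (flip k z))
             (fun z => -1 * (g z * wal i z))) in A.
  - rewrite mean_scal in A. unfold step_coef. lra.
  - intros z _. rewrite E, (Hg (flip k z) z) by (now apply agree_flip). ring.
Qed.

Lemma step_spart (n : nat) (z : digits) : (2 ^ N <= n)%nat -> spart step_coef n z = g z.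
Proof.
  intros Hn. unfold spart. replace n with (2 ^ N + (n - 2 ^ N))%nat by lia.
  rewrite rsum_split.
  rewrite (rsum_ext (fun i => step_coef (2 ^ N + i) * wal (2 ^ N + i) z) (fun _ => 0)).
  2:{ intros i _. rewrite step_coef_high by lia. ring. }
  rewrite rsum_const, Rmult_0_r, Rplus_0_r.
  rewrite (rsum_ext _ (fun i => mean N (fun y => g y * wal i y) * wal i z)).
  2:{ intros i Hi. rewrite (step_coef_mean N) by lia. reflexivity. }
  fold (spart (fun i => mean N (fun y => g y * wal i y)) (2 ^ N) z).
  rewrite spart_mean. fold (D2 N).
  (* [D2 N] vanishes unless [y] and [z] share their level-[N] cell, where [g] is constant;
     truncating [z] provides the finite support required by [mean_D2]. *)
  rewrite (mean_ext N _ (fun y => g z * D2 N (sxor y (strunc N z)))).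
  - rewrite mean_scal, mean_D2 by (auto using supp_strunc). ring.
  - intros y _. fold (D2 N (sxor z y)). rewrite (sxor_comm z y).
    rewrite (D2_depends N (sxor y z) (sxor y (strunc N z))).
    + destruct (classic (agree N y (strunc N z))) as [H|H].
      * rewrite (Hg y z); [reflexivity|]. apply agree_trans with (strunc N z); [assumption|].
        now apply strunc_agree.
      * rewrite D2_not_agree by assumption. ring.
    + apply agree_sxor; [now intros k|]. apply agree_sym. now apply strunc_agree.
Qed.

(** Only the partial sums of order below $2^N$ differ from [g], and their weights are at most 1
    before division by $l_n$. *)
Lemma step_lmean (z : digits) : exists B, 0 <= B /\ forall n, (2 <= n)%nat ->
  Rabs (lmean step_coef n z - g z) <= B * / lsum n.
Proof.
  set (h := fun k => Rabs (spart step_coef k z - g z)).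
  exists (rsum h (2 ^ N)). split; [apply rsum_nonneg; intros; apply Rabs_pos|].
  intros n Hn. assert (Hl := lsum_pos n Hn).
  replace (lmean step_coef n z - g z) with
    (/ lsum n * rsum (fun i => (spart step_coef (n - 1 - i) z - g z) * / INR (S i)) (n - 1)).
  - rewrite Rabs_mult, Rabs_inv, (Rabs_right (lsum n)), Rmult_comm by lra.
    apply Rmult_le_compat_r; [apply Rlt_le, Rinv_0_lt_compat; assumption|].
    eapply Rle_trans; [apply rsum_abs|].
    apply Rle_trans with (rsum (fun i => h (n - 1 - i)%nat) (n - 1)).
    + apply rsum_le. intros i _. rewrite Rabs_mult. fold (h (n - 1 - i)%nat).
      assert (A := inv_INR_nonneg i). rewrite (Rabs_right (/ INR (S i))) by lra.
      rewrite <- (Rmult_1_r (h _)) at 2. apply Rmult_le_compat_l; [apply Rabs_pos|].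
      rewrite <- Rinv_1. apply Rinv_le_contravar; [lra|]. apply (le_INR 1). lia.
    + apply Rle_trans with (rsum h n).
      * rewrite (rsum_rev h n). apply rsum_mono; [lia|]. intros; apply Rabs_pos.
      * apply rsum_support; [intros; apply Rabs_pos|]. intros k Hk. unfold h.
        rewrite step_spart by assumption. rewrite Rminus_diag. apply Rabs_R0.
  - unfold lmean.
    rewrite (rsum_ext _ (fun i => spart step_coef (n - 1 - i) z * / INR (S i)
               + - g z * / INR (S i))) by (intros; ring).
    rewrite rsum_plus, rsum_scal. fold (harm (n - 1)). rewrite <- lsum_harm. field. lra.
Qed.
End StepFunction.

Lemma Un_cv_step_lmean (g : digits -> R) (N : nat) (m : nat -> nat) (z : digits) :
  depends N g -> (forall A, (m A < m (S A))%nat) -> (2 <= m O)%nat ->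
  Un_cv (fun A => lmean (step_coef g N) (m A) z) (g z).
Proof.
  intros Hg Hm Hm0 e He. destruct (step_lmean g N Hg z) as [B [HB HBn]].
  assert (HmA : forall A, (A + 2 <= m A)%nat).
  { induction A as [|A IH]; [lia|]. specialize (Hm A). lia. }
  destruct (INR_unbounded (2 * B / e)) as [K HK]. exists (2 ^ K)%nat. intros A HA.
  specialize (HmA A). unfold Rdist. eapply Rle_lt_trans; [apply HBn; lia|].
  assert (Hl := lsum_pos (m A) ltac:(lia)).
  assert (H : INR K / 2 <= lsum (m A)).
  { eapply Rle_trans; [|apply lsum_mono with (a := (2 ^ K)%nat); lia].
    eapply Rle_trans; [|apply lsum_log; assert (P := pow2_nat_pos K); lia].
    rewrite Nat.log2_pow2 by lia. lra. }
  apply Rmult_lt_reg_r with (lsum (m A)); [assumption|].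
  rewrite Rmult_assoc, Rinv_l, Rmult_1_r by lra.
  assert (H2 : 2 * B < INR K * e).
  { apply Rmult_lt_reg_r with (/ e); [now apply Rinv_0_lt_compat|].
    replace (INR K * e * / e) with (INR K) by (field; lra). exact HK. }
  nra.
Qed.

(** * Maximal inequality and almost everywhere convergence *)

Section Maximal.
Context (m : nat -> nat) (Hm2 : forall A, (2 <= m A)%nat).
Context (C : R) (HC : forall A, cond_term (m A) <= C).
Context (f : R -> R) (c : nat -> R).
Context (Hc : forall i, is_integral01 (fun t => f t * walsh i t) (c i)).
Context (I eps : R) (delta : R -> R) (N : nat) (t : digits -> R).
Context (Hdelta : forall x, 0 < delta x).
Context (Hgauge : forall M tag, fine_tagging delta M tag ->
                    Rabs (mean M (fun z => f (tag z)) - I) < eps).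
Context (Ht : forall z, cell_fine delta N z (t z)).

Let g : digits -> R := step f N t.

(** Orders below $2^M$ are treated at a finer level [L], whose tags make [phi] of mean at most
    [4 * eps]; [weak_type] doubles this. The bound is uniform in [M], so [covered_dyadic] removes
    the restriction on the orders. *)
Lemma maximal_covered (lam : R) : 0 < lam ->
  covered (fun x => 0 <= x < 1 /\ exists A,
      2 * (3 * lam * (14 + 2 * Rabs C))
      < Rabs (lmean (fun i => c i - step_coef g N i) (m A) (xdigit x))) (8 * eps / lam).
Proof.
  intros Hlam. set (thr := 3 * lam * (14 + 2 * Rabs C)).
  assert (HC0 := Rabs_pos C). assert (Hthr : 0 < thr) by (unfold thr; nra).
  set (d := fun i => c i - step_coef g N i).
  set (E := fun M z => exists A, (m A < 2 ^ M)%nat /\ 2 * thr < Rabs (lmean d (m A) z)).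
  assert (HE : forall M x y, agree M x y -> E M x -> E M y).
  { intros M x y Hxy [A [HA HL]]. exists A. split; [assumption|].
    now rewrite <- (lmean_depends d (m A) M (Nat.lt_le_incl _ _ HA) x y Hxy). }
  apply covered_sub with (fun x => 0 <= x < 1 /\ exists M, E M (xdigit x)) (8 * eps / lam);
    [|lra|].
  { intros x [Hx [A HA]]. split; [assumption|]. exists (m A), A.
    split; [apply Nat.pow_gt_lin_r; lia|assumption]. }
  apply covered_dyadic; [|exact HE|].
  { intros M z [A [HA HL]]. exists A. split; [|assumption]. simpl. lia. }
  intros M. assert (P := pow2_pos M).
  (* The denominator absorbs the factor $n<2^M$ lost in [lmean_small]. *)
  destruct (coefficient_mean f c M (thr / 2 ^ M) Hc ltac:(now apply Rdiv_lt_0_compat))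
    as [d1 [Hd1 H1]].
  destruct (fine_tags_exist (fun x => Rmin (d1 x) (delta x)) (Nat.max M N)) as [L [HL [s Hs]]].
  { intros x. now apply Rmin_glb_lt. }
  assert (Hs1 : fine_tagging d1 L s).
  { intros z _. eapply cell_fine_gauge; [|apply Hs]. intros; apply Rmin_l. }
  specialize (H1 L s ltac:(lia) Hs1).
  set (phi := fun z => Rabs (f (s z) - g z)).
  assert (Hphi : mean L phi <= 4 * eps).
  { assert (A := step_exchange f I eps delta N t Hgauge Ht L s (fun _ => True) ltac:(lia)
      (fun z _ _ => cell_fine_gauge _ delta L z (s z) (fun x => Rmin_r _ _) (Hs z))).
    eapply Rle_trans; [|exact A]. apply mean_le. intros z _.
    rewrite chi_true by exact Logic.I. unfold phi, g. lra. }
  assert (W := weak_type L phi (fun z => Rabs_pos _) lam Hlam).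
  apply Rle_trans with (2 * mean L phi / lam).
  2:{ unfold Rdiv. apply Rmult_le_compat_r; [apply Rlt_le, Rinv_0_lt_compat; assumption|lra]. }
  eapply Rle_trans; [|exact W].
  (* [E M] depends on [M] digits only, so its measure may be computed at level [L]. *)
  rewrite <- (mean_depends L M).
  2:{ intros x y Hxy. apply Rle_antisym; apply chi_mono; apply HE;
        [|apply agree_sym]; assumption. }
  2:{ lia. }
  apply mean_le. intros z _. apply chi_mono. intros [A [HA Hbig]] Hgood.
  specialize (Hm2 A). set (n := m A) in *.
  assert (Hn : (2 <= n < 2 ^ L)%nat).
  { split; [assumption|]. apply Nat.lt_le_trans with (2 ^ M)%nat; [assumption|].
    apply Nat.pow_le_mono_r; lia. }
  assert (K := kernel_norm_nkernel L phi (fun z => Rabs_pos _) lam C n z Hgood Hn (HC A)).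
  fold thr in K. assert (Hl := lsum_pos n Hm2).
  (* [e1] is the quadrature error, [e2] the exact coefficient of [f (s y) - g y], whose logarithmic
     mean is a convolution; each costs one [thr]. *)
  set (e1 := fun i => c i - mean L (fun y => f (s y) * wal i y)).
  set (e2 := fun i => mean L (fun y => (f (s y) - g y) * wal i y)).
  assert (S1 : Rabs (lmean e1 n z) <= thr).
  { eapply Rle_trans; [apply (lmean_small e1 n z (thr / 2 ^ M)); [assumption|]|].
    - intros i Hi. unfold e1. rewrite Rabs_minus_sym. apply Rlt_le, H1. lia.
    - apply Rle_trans with (thr / 2 ^ M * 2 ^ M).
      + apply Rmult_le_compat_l; [apply Rlt_le; now apply Rdiv_lt_0_compat|].
        rewrite <- INR_pow2. apply le_INR. lia.
      + apply Req_le. field. lra. }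
  assert (S2 : Rabs (lmean e2 n z) <= thr).
  { unfold e2. rewrite (lmean_mean (fun y => f (s y) - g y)), Rabs_mult, Rabs_inv.
    rewrite (Rabs_right (lsum n)) by lra.
    apply Rmult_le_reg_l with (lsum n); [assumption|].
    rewrite <- Rmult_assoc, Rinv_r, Rmult_1_l, Rmult_comm by lra.
    eapply Rle_trans; [apply mean_abs|]. eapply Rle_trans; [|exact K].
    apply Req_le, mean_ext. intros y _. apply Rabs_mult. }
  assert (S3 : lmean d n z = lmean e1 n z + lmean e2 n z).
  { rewrite <- lmean_plus. apply lmean_ext. intros i Hi. unfold d, e1, e2.
    rewrite (step_coef_mean g N (step_depends f N t) L i) by lia.
    rewrite (mean_ext L (fun y => (f (s y) - g y) * wal i y)
               (fun y => f (s y) * wal i y - g y * wal i y)) by (intros; ring).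
    rewrite mean_minus. ring. }
  rewrite S3 in Hbig. assert (T := Rabs_triang (lmean e1 n z) (lmean e2 n z)). lra.
Qed.
End Maximal.

Lemma increasing_ge_2 (m : nat -> nat) :
  (forall A, (m A < m (S A))%nat) -> (2 <= m O)%nat -> forall A, (2 <= m A)%nat.
Proof. intros Hm Hm0. induction A as [|A IH]; [assumption|]. specialize (Hm A). lia. Qed.

Lemma oscillation_covered (m : nat -> nat) (C : R) (f : R -> R) (c : nat -> R) (tau e : R) :
  (forall A, (m A < m (S A))%nat) -> (2 <= m O)%nat ->
  (forall A, cond_term (m A) <= C) -> L1 f ->
  (forall i, is_integral01 (fun t => f t * walsh i t) (c i)) -> 0 < tau -> 0 < e ->
  covered (fun x => 0 <= x < 1 /\
    ~ exists A0, forall A, (A0 <= A)%nat -> Rabs (Lmean c (m A) x - f x) < tau) e.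
Proof.
  intros Hm Hm0 HC [I HI] Hc Htau He. assert (HC0 := Rabs_pos C).
  (* Turns the threshold of [maximal_covered] into [tau / 3]. *)
  set (lam := tau / (18 * (14 + 2 * Rabs C))).
  assert (Hlam : 0 < lam) by (apply Rdiv_lt_0_compat; nra).
  (* With precision [e / w] the two exceptional sets have bounds adding up to [e]. *)
  set (w := 8 / lam + 4 / (tau / 3)).
  assert (Hw : 0 < w) by (apply Rplus_lt_0_compat; apply Rdiv_lt_0_compat; lra).
  destruct (integral_mean f I (e / w) HI ltac:(now apply Rdiv_lt_0_compat))
    as [delta [Hdelta Hgauge]].
  destruct (fine_tags_exist delta 0 Hdelta) as [N [_ [t Ht]]].
  set (g := step f N t).
  assert (V1 := maximal_covered m (increasing_ge_2 m Hm Hm0) C HC f c Hc I (e / w) delta N t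
                  Hdelta Hgauge Ht lam Hlam).
  assert (V2 := step_approx_covered f I (e / w) delta N t Hdelta Hgauge Ht (tau / 3)
                  ltac:(lra)).
  assert (V := covered_or _ _ _ _ V1 V2). eapply covered_sub; [| |exact V].
  - intros x [Hx Hosc]. apply NNPP. intros Hno. apply Hosc.
    destruct (Un_cv_step_lmean g N m (xdigit x) (step_depends f N t) Hm Hm0 (tau / 3) ltac:(lra))
      as [A0 HA0].
    exists A0. intros A HA. specialize (HA0 A HA). unfold Rdist in HA0.
    assert (B1 : Rabs (lmean (fun i => c i - step_coef g N i) (m A) (xdigit x)) <= tau / 3).
    { apply Rnot_lt_le. intros Hlt. apply Hno. left. split; [assumption|]. exists A.
      replace (2 * (3 * lam * (14 + 2 * Rabs C))) with (tau / 3)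
        by (unfold lam; field; lra). exact Hlt. }
    assert (B2 : Rabs (f x - g (xdigit x)) <= tau / 3).
    { apply Rnot_lt_le. intros Hlt. apply Hno. right. now split. }
    rewrite Lmean_lmean.
    replace (lmean c (m A) (xdigit x)) with
      (lmean (fun i => c i - step_coef g N i) (m A) (xdigit x)
       + lmean (step_coef g N) (m A) (xdigit x)).
    2:{ rewrite <- lmean_plus. apply lmean_ext. intros; ring. }
    revert B1 HA0 B2. unfold Rabs. repeat destruct Rcase_abs; lra.
  - apply Req_le. unfold w. field. lra.
Qed.

Theorem theorem2 :
  forall m : nat -> nat,
    (forall A, (m A < m (S A))%nat) ->
    (2 <= m O)%nat ->
    (exists C : R, forall A, cond_term (m A) <= C) ->
  forall f : R -> R, L1 f ->
  forall c : nat -> R,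
    (forall i, is_integral01 (fun t => f t * walsh i t) (c i)) ->
  exists N : R -> Prop, null_set N /\
    forall x, 0 <= x < 1 -> ~ N x ->
      Un_cv (fun A => Lmean c (m A) x) (f x).
Proof.
  intros m Hm Hm0 [C HC] f Hf c Hc.
  (* Countably many tolerances $1/(j+1)$ detect every failure of convergence; the set for [j] is
     covered with total length $e2^{-(j+1)}$. *)
  set (osc := fun (j : nat) x => 0 <= x < 1 /\
    ~ exists A0, forall A, (A0 <= A)%nat -> Rabs (Lmean c (m A) x - f x) < / INR (S j)).
  exists (fun x => exists j, osc j x). split.
  - intros e He. change (covered (fun x => exists j, osc j x) e).
    apply covered_union with (fun j => e * / 2 ^ S j).
    + intros j. assert (P := pow2_pos (S j)). apply oscillation_covered with C; try assumption.
      * apply Rinv_0_lt_compat, lt_0_INR. lia.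
      * apply Rmult_lt_0_compat; [assumption|]. now apply Rinv_0_lt_compat.
    + intros K. rewrite rsum_scal.
      assert (H : rsum (fun j => / 2 ^ S j) K = 1 - / 2 ^ K).
      { induction K as [|K IH]; [simpl; lra|]. cbn [rsum]. rewrite IH.
        assert (P := pow2_pos K). simpl. field. lra. }
      rewrite H. assert (0 < / 2 ^ K) by (apply Rinv_0_lt_compat, pow2_pos). nra.
  - intros x Hx Hno e He.
    destruct (archimed_cor1 e He) as [j [Hj1 Hj2]].
    apply NNPP. intros Hcv. apply Hno. exists (j - 1)%nat. split; [assumption|].
    intros [A0 HA0]. apply Hcv. exists A0. intros A HA. unfold Rdist.
    specialize (HA0 A HA). replace (S (j - 1)) with j in HA0 by lia. lra.
Qed.
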